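(* Let $0<r<1$, $1\leq p\leq\infty$, $\alpha>0$ and $\beta\in\mathbb{R}$, and let $p'$ be defined by $\frac1p+\frac1{p'}=1$. Then for every integer $n\geq n_0(\alpha,r,p)$ there is a real number $\gamma_{n,p}^{(1)}=\gamma_{n,p}^{(1)}(\alpha,r,\beta)$ with $|\gamma_{n,p}^{(1)}|\leq(14\pi)^{2}$ such that $$ {\cal E}_{n}(C^{\alpha,r}_{\beta,p})_{C}= e^{-\alpha n^{r}}n^{\frac{1-r}{p}}\bigg(\frac{\|\cos t\|_{p'}}{\pi^{1+\frac{1}{p'}}(\alpha r)^{\frac{1}{p}}}J_{p'}\Big(\frac{ \pi n^{1-r}}{\alpha r}\Big) +\gamma_{n,p}^{(1)}\Big(\frac{1}{(\alpha r)^{1+\frac{1}{p}}}J_{p'}\Big(\frac{ \pi n^{1-r}}{\alpha r}\Big)\frac{1}{n^{r}}+\frac{1}{n^{\frac{1-r}{p}}}\Big)\bigg). $$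
   Context: Convention: $1/\infty=0$, so $p=1$ corresponds to $p'=\infty$ and $p=\infty$ to $p'=1$. For $1\le p<\infty$, $L_p$ is the space of $2\pi$-periodic functions $f$ summable to the power $p$ on $[0,2\pi)$, with norm $\|f\|_{p}=\big(\int_{0}^{2\pi}|f(t)|^{p}dt\big)^{1/p}$; $L_\infty$ is the space of measurable essentially bounded $2\pi$-periodic functions with $\|f\|_\infty=\operatorname{ess\,sup}_t|f(t)|$; $C$ is the space of continuous $2\pi$-periodic functions with $\|f\|_C=\max_t|f(t)|$. Generalized Poisson kernel: $P_{\alpha,r,\beta}(t)=\sum_{k=1}^{\infty}e^{-\alpha k^{r}}\cos\big(kt-\frac{\beta\pi}{2}\big)$. $B_p^0=\{\varphi\in L_p:\ \|\varphi\|_p\le 1,\ \int_{-\pi}^{\pi}\varphi(t)\,dt=0\}$ (real-valued functions). $C^{\alpha,r}_{\beta,p}$ is the set of all $2\pi$-periodic functions $f$ representable for all $x\in\mathbb{R}$ as $f(x)=\frac{a_0}{2}+\frac1\pi\int_{-\pi}^{\pi}P_{\alpha,r,\beta}(x-t)\varphi(t)\,dt$ with $a_0\in\mathbb{R}$ and $\varphi\in B_p^0$. ${\cal E}_{n}(C^{\alpha,r}_{\beta,p})_{C}=\sup_{f\in C^{\alpha,r}_{\beta,p}}\|f(\cdot)-S_{n-1}(f;\cdot)\|_{C}$, where $S_{n-1}(f;\cdot)$ is the partial Fourier sum of order $n-1$ of $f$ (harmonics of degree $0,\dots,n-1$). For $\upsilon>0$: $J_s(\upsilon)=\Big(\int_0^{\upsilon}(t^2+1)^{-s/2}dt\Big)^{1/s}$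 for $1\le s<\infty$, and $J_\infty(\upsilon)=\operatorname{ess\,sup}_{t\in[0,\upsilon]}(t^2+1)^{-1/2}$. $\chi(p)=p$ for $1\le p<\infty$ and $\chi(\infty)=1$. $n_0=n_0(\alpha,r,p)$ is the smallest positive integer $n$ such that $$\frac{1}{\alpha r}\frac{1}{n^{r}}+\frac{\alpha r\,\chi(p)}{n^{1-r}}\leq \kappa(p),$$ where $\kappa(1)=\frac1{14}$, $\kappa(p)=\frac{1}{(3\pi)^3}\cdot\frac{p-1}{p}$ for $1<p<\infty$, and $\kappa(\infty)=\frac{1}{(3\pi)^3}$. *)

(* Defs.v *)
From HB Require Import structures.
From mathcomp Require Import all_boot all_order all_algebra.
From mathcomp Require Import all_classical all_reals all_analysis ess_sup_inf.

Set Implicit Arguments.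
Unset Strict Implicit.
Unset Printing Implicit Defensive.
Import Order.TTheory GRing.Theory Num.Theory.
Import numFieldNormedType.Exports.

Local Open Scope classical_set_scope.
Local Open Scope ring_scope.

(* The real number 1/p for p in [1, +oo], with 1/oo = 0. *)
Definition rinv {R : realType} (p : \bar R) : R := fine (p^-1)%E.

Definition period_measure (R : realType) :
    {measure set (measurableTypeR R) -> \bar R} :=
  mrestr (@lebesgue_measure R) (measurable_itv `[0, 2 * pi[).

Definition normL {R : realType} (p : \bar R) (f : R -> R) : \bar R :=
  Lnorm (period_measure R) p (EFin \o f).

(* Measurability is Borel measurability; up to null sets this yields the same
   functions as Lebesgue measurability. *)
Definition Lper {R : realType} (p : \bar R) : set (R -> R) :=
  [set f | [/\ periodic f (2 * pi),
               measurable_fun [set: measurableTypeR R]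
                 (f : measurableTypeR R -> measurableTypeR R) &
               (normL p f < +oo)%E]].

(* For continuous periodic f the supremum is the maximum. *)
Definition normC {R : realType} (f : R -> R) : \bar R :=
  ereal_sup (range (fun t => `|f t|%:E)).

Definition poisson_kernel {R : realType} (alpha r beta : R) (t : R) : R :=
  limn (fun m => \sum_(1 <= k < m)
    expR (- alpha * k%:R `^ r) * cos (k%:R * t - beta * pi / 2)).

Definition mean0_ball {R : realType} (p : \bar R) : set (R -> R) :=
  [set phi | [/\ Lper p phi, (normL p phi <= 1)%E &
    \int[lebesgue_measure]_(t in `[- pi, pi]) phi t = 0]].

Definition poisson_class {R : realType} (alpha r beta : R) (p : \bar R)
    : set (R -> R) :=
  [set f | periodic f (2 * pi) /\
    exists a0 : R, exists2 phi : R -> R, mean0_ball p phi &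
      forall x, f x = a0 / 2 + pi^-1 *
        \int[lebesgue_measure]_(t in `[- pi, pi])
          (poisson_kernel alpha r beta (x - t) * phi t)].

Definition fourier_cos {R : realType} (f : R -> R) (k : nat) : R :=
  pi^-1 * \int[lebesgue_measure]_(t in `[- pi, pi]) (f t * cos (k%:R * t)).

Definition fourier_sin {R : realType} (f : R -> R) (k : nat) : R :=
  pi^-1 * \int[lebesgue_measure]_(t in `[- pi, pi]) (f t * sin (k%:R * t)).

(* Harmonics of degree 0, ..., m. *)
Definition fourier_sum {R : realType} (m : nat) (f : R -> R) (x : R) : R :=
  fourier_cos f 0 / 2 +
  \sum_(1 <= k < m.+1)
    (fourier_cos f k * cos (k%:R * x) + fourier_sin f k * sin (k%:R * x)).

(* Meaningful for n >= 1. *)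
Definition fourier_error {R : realType} (n : nat) (alpha r beta : R)
    (p : \bar R) : \bar R :=
  ereal_sup [set normC (fun x => f x - fourier_sum n.-1 f x)
            | f in poisson_class alpha r beta p].

(* Meaningful for s >= 1. *)
Definition J {R : realType} (s : \bar R) (v : R) : R :=
  match s with
  | q%:E => (\int[lebesgue_measure]_(t in `[0, v])
               (t ^+ 2 + 1) `^ (- (q / 2))) `^ q^-1
  | _ => fine (ess_sup (mrestr (@lebesgue_measure R) (measurable_itv `[0, v]))
                 (fun t : R => ((t ^+ 2 + 1) `^ (- (1 / 2)))%:E))
  end.

Definition chi {R : realType} (p : \bar R) : R :=
  if p is q%:E then q else 1.

Definition kappa {R : realType} (p : \bar R) : R :=
  match p with
  | q%:E => if q == 1 then 1 / 14 else 1 / (3 * pi) ^+ 3 * ((q - 1) / q)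
  | _ => 1 / (3 * pi) ^+ 3
  end.

Definition n0_cond {R : realType} (alpha r : R) (p : \bar R) (n : nat) : bool :=
  1 / (alpha * r) * (1 / n%:R `^ r) + alpha * r * chi p / n%:R `^ (1 - r)
    <= kappa p.

Definition n0 {R : realType} (alpha r : R) (p : \bar R) : nat :=
  xget 0%N [set n | [/\ (0 < n)%N, n0_cond alpha r p n &
    forall m, (0 < m)%N -> n0_cond alpha r p m -> (n <= m)%N]].

Lemma kappa_gt0 {R : realType} (p : \bar R) : (1 <= p)%E -> 0 < kappa p.
Proof.
have pi3 : 0 < 1 / (3 * pi : R) ^+ 3.
  by rewrite divr_gt0// exprn_gt0// mulr_gt0// pi_gt0.
case: p => [q| |]//=; rewrite lee_fin => q1.
case: eqVneq => [//|qn1]; have {}q1 : 1 < q by rewrite lt_neqAle eq_sym qn1.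
by rewrite mulr_gt0// divr_gt0 ?subr_gt0// (lt_trans ltr01).
Qed.

Lemma n0_cond_witness {R : realType} (alpha r : R) (p : \bar R) :
  0 < alpha -> 0 < r < 1 -> (1 <= p)%E ->
  exists n, (0 < n)%N && n0_cond alpha r p n.
Proof.
move=> a0 /andP[r0 r1] p1.
have k0 := kappa_gt0 p1.
have chi0 : 0 < chi p.
  by case: p p1 {k0} => [q| |]//=; rewrite lee_fin; exact: lt_le_trans.
have ar0 : 0 < alpha * r by rewrite mulr_gt0.
have small (c s : R) : 0 < c -> 0 < s ->
    exists N, forall n, (N <= n)%N -> c / n%:R `^ s <= kappa p / 2.
  move=> c0 s0; pose M := (2 * c / kappa p) `^ s^-1.
  exists (Num.truncn M).+1 => n Nn.
  have Mn : M <= n%:R.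
    rewrite (le_trans (ltW (truncnS_gt _)))//.
    by rewrite ler_nat.
  have d0 : 0 < 2 * c / kappa p by rewrite divr_gt0// mulr_gt0.
  have M0 : 0 < M by exact: powR_gt0.
  have n0 : 0 < n%:R :> R by exact: lt_le_trans Mn.
  rewrite ler_pdivrMr ?powR_gt0// mulrAC ler_pdivlMr// -ler_pdivrMl// mulrC.
  rewrite [c * 2]mulrC.
  have <- : M `^ s = 2 * c / kappa p.
    by rewrite -powRrM mulVf ?gt_eqF// powRr1// ltW.
  by apply: ge0_ler_powR => //; rewrite ?nnegrE ltW.
have [N1 h1] := small (1 / (alpha * r)) r (divr_gt0 ltr01 ar0) r0.
have [N2 h2] := small (alpha * r * chi p) (1 - r) (mulr_gt0 ar0 chi0)
  (etrans (subr_gt0 _ _) r1).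
exists (maxn N1 N2).+1 => /=; rewrite /n0_cond [leRHS](splitr (kappa p)).
rewrite [1 / _ `^ r]mul1r lerD//.
- by apply: h1; rewrite leqW// leq_maxl.
- by apply: h2; rewrite leqW// leq_maxr.
Qed.

Lemma n0P {R : realType} (alpha r : R) (p : \bar R) :
  0 < alpha -> 0 < r < 1 -> (1 <= p)%E ->
  [/\ (0 < n0 alpha r p)%N, n0_cond alpha r p (n0 alpha r p) &
    forall m, (0 < m)%N -> n0_cond alpha r p m -> (n0 alpha r p <= m)%N].
Proof.
move=> a0 r01 p1; have ex := n0_cond_witness a0 r01 p1.
apply: (@xgetPex _ 0%N [set n | [/\ (0 < n)%N, n0_cond alpha r p n &
  forall m, (0 < m)%N -> n0_cond alpha r p m -> (n <= m)%N]]).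
have [m /andP[m0 cm] mmin] := ex_minnP ex.
exists m; split => // k k0 ck.
by apply: mmin; rewrite k0.
Qed.

(* Main.v *)
(* Put N = alpha r n^r and d = N / n; beyond n0, N is large and d is small.
   After factoring e^(-alpha n^r), the kernel's tail from harmonic n on is
   sum_j a_j cos((n + j) t - b) with a_0 = 1 and a_(j+1) >= q a_j, q = e^(-d), so
   by Abel summation it is close to the geometric sum, that is to
   A(t) cos(n t - b + theta(t)) where A e^(i theta) = 1 / (1 - q e^(it)).
   Freezing A and theta on each of the n cells of length 2 pi / n costs
   O(1 + A / N) and leaves a wave M that runs through exactly one period of the
   cosine on every cell.  Hence the s-norm of M is (2 pi)^(-1/s) times the
   s-norm of the cosine times that of the frozen A, and
   A(t) = (d^2 + t^2)^(-1/2) + O(1) relates the latter to J_s(pi / d).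
   By Hoelder's inequality the error of the Fourier sums is at most the
   conjugate norm of the tail over pi; conversely one tests the tail against
   g(M) with g odd (g(x) = c sgn(x) |x|^(s-1), or a signed indicator of
   {|x| >= lam} when p = 1), which has mean zero automatically. *)

Require Import Defs.
From HB Require Import structures.
From mathcomp Require Import all_boot all_order all_algebra.
From mathcomp Require Import all_classical all_reals all_analysis.
From mathcomp Require Import ess_sup_inf measurable_realfun ring lra.

Set Implicit Arguments.
Unset Strict Implicit.
Unset Printing Implicit Defensive.
Import Order.TTheory GRing.Theory Num.Theory.
Import numFieldNormedType.Exports.

Local Open Scope classical_set_scope.
Local Open Scope ring_scope.

(** * Decay of the coefficients *)

(** The constant [(14 pi)^2] must serve every p at once. So each comparison is made pointwise, with
    an error [C + C' A(t) / N], and only then carried to the s-norm by Minkowski's inequality: a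
    constant C costs at most [8 C] because [(2 pi)^(1/s) <= 2 pi < 8], while [A / N] gives back the
    main term divided by N. These are the two terms that multiply gamma. Both come from
    [d A <= 15/14]: the geometric approximation errs by A times [d + O(1/N)], and over a cell of
    length [2 pi / n] the wave moves by [A * O(A / n) = A * O(1 / N)], since [n d = N].

    The mean-zero condition could in general replace the conjugate norm by the distance to the
    constants. Bounding by the full norm loses nothing at leading order, because M is distributed
    symmetrically about 0. The tail itself need not have this symmetry; hence the tests are built
    from M, and the tail minus M is an error term. For p = 1 a function of L_1 need not attain the
    sup norm, so near-extremal functions are used. The threshold enters through [14 <= N] and
    [d <= 1/14], which follow from [kappa p <= 1/14]. *)

Section coefficients.
Context {R : realType}.
Implicit Types r x y t al : R.

(** Young's inequality for the product of [x^r] and 1, with exponents [1/r] and [1/(1-r)]. *)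
Lemma powR_le_tangent x r : 0 <= x -> 0 < r < 1 ->
  x `^ r <= 1 + r * (x - 1).
Proof.
move=> x0 /andP[r0 r1].
have r'0 : 0 < 1 - r by rewrite subr_gt0.
have := @conjugate_powR R (x `^ r) 1 r^-1 (1 - r)^-1.
rewrite powR_ge0 ler01 !invr_gt0 r0 r'0 !invrK => /(_ isT isT isT isT).
rewrite subrKC => /(_ erefl).
rewrite mulr1 -powRrM mulfV ?gt_eqF// powRr1// powR1; lra.
Qed.

(** Concavity of [x^r]: factoring out [x^r] reduces the increment to the tangent bound at 1. *)
Lemma powR_succ_le x r : 0 < x -> 0 < r < 1 ->
  (x + 1) `^ r - x `^ r <= r * (x `^ r / x).
Proof.
move=> x0 r01.
have h : x + 1 = x * ((x + 1) / x) by rewrite mulrCA mulfV ?gt_eqF// mulr1.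
have u0 : 0 <= (x + 1) / x by rewrite divr_ge0// ltW// addr_gt0.
rewrite [in X in X <= _]h powRM ?(ltW x0)//.
have := ler_wpM2l (powR_ge0 x r) (powR_le_tangent u0 r01).
have -> : (x + 1) / x - 1 = x^-1 by rewrite mulrDl mulfV ?gt_eqF// mul1r; ring.
rewrite mulrDr mulr1 mulrCA; lra.
Qed.

Lemma powR_pred_ge x r : 1 <= x -> 0 < r < 1 ->
  r * (x `^ r / x) <= x `^ r - (x - 1) `^ r.
Proof.
move=> x1 r01; have x0 : 0 < x by exact: lt_le_trans x1.
have h : x - 1 = x * ((x - 1) / x) by rewrite mulrCA mulfV ?gt_eqF// mulr1.
have u0 : 0 <= (x - 1) / x by rewrite divr_ge0// ?subr_ge0// ltW.
rewrite [in X in _ <= X]h powRM ?(ltW x0)//.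
have := ler_wpM2l (powR_ge0 x r) (powR_le_tangent u0 r01).
have -> : (x - 1) / x - 1 = - x^-1 by rewrite mulrBl mulfV ?gt_eqF// mul1r; ring.
rewrite mulrDr mulr1 mulrN mulrN mulrCA; lra.
Qed.

Lemma powR_div_le x y r : 0 < x -> x <= y -> 0 < r < 1 ->
  y `^ r / y <= x `^ r / x.
Proof.
move=> x0 xy /andP[r0 r1]; have y0 : 0 < y by exact: lt_le_trans xy.
have E z : 0 < z -> z `^ r / z = (z `^ (1 - r))^-1.
  move=> z0; rewrite -powRN opprB powRB ?powRr1 ?ltW//.
  by rewrite (gt_eqF z0) implybT.
rewrite !E// lef_pV2 ?posrE ?powR_gt0// ge0_ler_powR// ?nnegrE ?ltW//.
by rewrite subr_gt0.
Qed.

Definition decay al r n j : R := expR (- al * ((n + j)%:R `^ r - n%:R `^ r)).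

(** The d and N of the overview; [dlt] is the derivative of [al * x^r] at [x = n]. *)
Definition dlt al r n : R := al * r * (n%:R `^ r / n%:R).
Definition Neps al r n : R := al * r * n%:R `^ r.

Variables (al r : R) (n : nat).
Hypotheses (al0 : 0 < al) (r01 : 0 < r < 1) (n0 : (0 < n)%N).
Let nR0 : 0 < n%:R :> R. Proof. by rewrite ltr0n. Qed.
Local Notation dl := (dlt al r n).
Local Notation N := (Neps al r n).
Let r0 : 0 < r. Proof. by case/andP: r01. Qed.
Local Notation a := (decay al r n).

Lemma decay0 : a 0 = 1.
Proof. by rewrite /decay addn0 subrr mulr0 expR0. Qed.

Lemma decay_ge0 j : 0 <= a j. Proof. exact: expR_ge0. Qed.

(** The exponent [al * x^r] is concave, so its increment after [n + j] is at most its slope there,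
    hence at most its slope d at n. *)
Lemma decay_ratio_ge j : expR (- dl) * a j <= a j.+1.
Proof.
rewrite /decay -expRD ler_expR addnS -natr1 -lerN2 opprD !mulNr !opprK.
have x0 : 0 < (n + j)%:R :> R by rewrite ltr0n addn_gt0 n0.
have h1 := powR_succ_le x0 r01.
have xn : n%:R <= (n + j)%:R :> R by rewrite ler_nat leq_addr.
have h2 := powR_div_le nR0 xn r01.
have := ler_wpM2l (ltW al0) (le_trans h1 (ler_wpM2l (ltW r0) h2)).
rewrite /dlt; lra.
Qed.

(** Stands in for comparing the sum with an integral. With [x = n + j + 1], [a j / a j.+1] is at
    least [1 + al r x^r / x >= 1 + N / x]; weighting by x makes the bound telescope. *)
Lemma decay_telescope j :
  (N - 1) * a j.+1 <= (n + j.+1)%:R * a j - (n + j.+2)%:R * a j.+1.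
Proof.
set x : R := (n + j.+1)%:R.
have x1 : 1 <= x by rewrite ler1n addnS.
have x0 : 0 < x by exact: lt_le_trans x1.
have h1 := powR_pred_ge x1 r01.
have ax : a j >= a j.+1 * (1 + al * r * (x `^ r / x)).
  rewrite /decay.
  have -> : - al * ((n + j)%:R `^ r - n%:R `^ r) =
     - al * (x `^ r - n%:R `^ r) + al * (x `^ r - (x - 1) `^ r).
    by rewrite /x addnS -natr1 addrK; ring.
  rewrite expRD ler_wpM2l ?expR_ge0//.
  rewrite (le_trans _ (expR_ge1Dx _))// lerD2l.
  by rewrite -mulrA ler_wpM2l// ltW.
have -> : (n + j.+2)%:R = x + 1 by rewrite /x !addnS natr1.
have nx : n%:R `^ r <= x `^ r.
  by rewrite ge0_ler_powR ?nnegrE// ?ltW// /x ltr_nat addnS ltnS leq_addr.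
have := ler_wpM2l (ltW x0) ax.
rewrite mulrCA mulrDr mulr1 mulrDr.
have -> : x * (al * r * (x `^ r / x)) = al * r * x `^ r.
  by rewrite mulrCA [x * _]mulrC divfK// gt_eqF.
have h3 : N <= al * r * x `^ r by rewrite /Neps ler_wpM2l// mulr_ge0// ltW.
have := ler_wpM2r (decay_ge0 j.+1) h3.
move: (x * a j) (al * r * x `^ r) (a j.+1) => {}ax z w h4 h5.
lra.
Qed.

Hypothesis N1 : 1 < N.

(** Sharp enough to matter: d times this bound is [1 + (1 + d) / (N - 1)], so in [geometric_approx]
    the 1 cancels and [d + O(1/N)] remains. *)
Lemma decay_sum_le m : \sum_(j < m) a j.+1 <= (n%:R + 1) / (N - 1).
Proof.
rewrite ler_pdivlMr ?subr_gt0// mulrC.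
suff : (N - 1) * \sum_(j < m) a j.+1 <= n%:R + 1 - (n + m.+1)%:R * a m.
  by move=> /le_trans; apply; rewrite gerBl mulr_ge0// decay_ge0.
elim: m => [|m IH]; first by rewrite big_ord0 mulr0 decay0 mulr1 addn1 natr1 subrr.
rewrite big_ord_recr/= mulrDr.
have := lerD IH (decay_telescope m).
by move: (a m) (a m.+1) => u w; rewrite addrA subrK.
Qed.

Lemma decay_cvg0 : a j @[j --> \oo] --> (0 : R).
Proof.
have : cvgn (series (fun j => a j.+1)).
  apply: nondecreasing_is_cvgn.
    by apply: nondecreasing_series => k _ _; exact: decay_ge0.
  exists ((n%:R + 1) / (N - 1)) => _ [m _ <-].
  by rewrite /series/= big_mkord decay_sum_le.
by move=> /cvg_series_cvg_0 h; rewrite -(cvg_shiftS a).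
Qed.

End coefficients.

(** * Amplitude and phase of the geometric series *)

Section geometric.
Context {R : realType}.
Implicit Types q t x y : R.

Lemma cos_lipschitz x y : `|cos x - cos y| <= `|x - y|.
Proof.
wlog xy : x y / x < y => [W|].
  have [/W//|/W|->] := ltgtP x y; last by rewrite !subrr normr0.
  by rewrite distrC [leRHS]distrC.
have [c _ h] : exists2 c : R, c \in `]x, y[ & cos y - cos x = - sin c * (y - x).
  apply: (MVT xy) => //.
  by apply: continuous_subspaceT => z; exact: continuous_cos.
by rewrite distrC h [leRHS]distrC normrM normrN ler_piMl// sin_max.
Qed.

Lemma sin_lipschitz x y : `|sin x - sin y| <= `|x - y|.
Proof.
rewrite -!cosBpihalf (le_trans (cos_lipschitz _ _))//.
by rewrite opprB addrA subrK.
Qed.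

Lemma sin_sub_id_le t : `|sin t - t| <= t ^+ 2.
Proof.
wlog t0 : t / 0 < t => [W|].
  have [/W//|t0|<-] := ltgtP 0 t; last by rewrite sin0 subrr normr0 expr2 mul0r.
  have : 0 < - t by rewrite oppr_gt0.
  by move=> /W; rewrite sinN -opprD normrN sqrrN.
have [c] : exists2 c : R, c \in `]0, t[ & sin t - sin 0 = cos c * (t - 0).
  apply: (MVT t0) => //.
  by apply: continuous_subspaceT => z; exact: continuous_sin.
rewrite sin0 !subr0 in_itv/= => /andP[c0 ct] ->.
rewrite -[X in _ - X]mul1r -mulrBl normrM expr2 (gtr0_norm t0) ler_pM2r//.
rewrite -cos0 (le_trans (cos_lipschitz _ _))// subr0 gtr0_norm// ltW//.
Qed.

Lemma ler_norm_sqr x y : `|x| <= `|y| -> x ^+ 2 <= y ^+ 2.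
Proof. by rewrite -ler_sqr ?nnegrE// !real_normK ?num_real. Qed.

Lemma one_sub_cosE t : 1 - cos t = 2 * sin (t / 2) ^+ 2.
Proof.
rewrite [in cos t](_ : t = t / 2 *+ 2); last by rewrite -mulr_natr divfK.
by rewrite cos_mulr2n cos2sin2; ring.
Qed.

Lemma one_sub_cos_le t : 1 - cos t <= t ^+ 2.
Proof.
rewrite one_sub_cosE.
have := sin_lipschitz (t / 2) 0; rewrite sin0 !subr0 => h.
have : sin (t / 2) ^+ 2 <= (t / 2) ^+ 2 by exact: ler_norm_sqr.
have := sqr_ge0 t; lra.
Qed.

(** A weak Jordan inequality. Up to [pi / 4] the slope of the sine is at least
    [cos (pi / 4) >= 2/3]; beyond, [sin x >= 2/3] while [x / 3 < 2/3]. *)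
Lemma sin_ge_third x : 0 <= x <= pi / 2 -> x / 3 <= sin x.
Proof.
move=> /andP[x0 x1].
have p0 := @pi_gt0 R; have p2 := @pihalf_lt2 R.
have c4 : cos (pi / 4) ^+ 2 = 1 / 2 :> R.
  have := @cos_mulr2n R (pi / 4).
  have -> : (pi / 4 : R) *+ 2 = pi / 2 by rewrite -mulr_natr; field.
  rewrite cos_pihalf; lra.
have cp : 0 < cos (pi / 4) :> R by apply: cos_gt0_pihalf; apply/andP; split; lra.
have c4' : 2 / 3 <= cos (pi / 4) :> R by nra.
have s4' : 2 / 3 <= sin (pi / 4) :> R.
  have : sin (pi / 4) ^+ 2 = 1 / 2 :> R by rewrite sin2cos2 c4; lra.
  have : 0 < sin (pi / 4) :> R by apply: sin_gt0_pihalf; apply/andP; split; lra.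
  nra.
have [x4|x4] := leP x (pi / 4); last first.
  have : sin (pi / 4) <= sin x :> R.
    apply: ltW; rewrite ltr_sin// in_itv/=; apply/andP; split; lra.
  lra.
move: x0; rewrite le_eqVlt => /predU1P[<-|x0]; first by rewrite mul0r sin0.
have [c] : exists2 c : R, c \in `]0, x[ & sin x - sin 0 = cos c * (x - 0).
  apply: (MVT x0) => //.
  by apply: continuous_subspaceT => z; exact: continuous_sin.
rewrite sin0 !subr0 in_itv/= => /andP[c0 cx] ->.
have : cos (pi / 4) <= cos c.
  apply: ltW; rewrite ltr_cos ?in_itv/=; [lra|apply/andP; split; lra..].
nra.
Qed.

Lemma one_sub_cos_ge t : `|t| <= pi -> t ^+ 2 / 18 <= 1 - cos t.
Proof.
move=> tp; rewrite -cos_norm one_sub_cosE -real_normK ?num_real//.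
have := @sin_ge_third (`|t| / 2); rewrite divr_ge0//= ler_pM2r ?invr_gt0// => /(_ tp).
have := normr_ge0 t; nra.
Qed.

Definition den_re q t : R := 1 - q * cos t.
(** The sign is that of the conjugate: [1 - q e^(it) = den_re - i den_im], so the reciprocal has
    argument [atan (den_im / den_re)]. *)
Definition den_im q t : R := q * sin t.
Definition den_norm2 q t : R := den_re q t ^+ 2 + den_im q t ^+ 2.
(* [1 / (1 - q e^(it)) = amp q t * e^(i phase q t)] *)
Definition amp q t : R := (Num.sqrt (den_norm2 q t))^-1.
Definition phase q t : R := atan (den_im q t / den_re q t).

Section fixed_ratio.
Variable q : R.
Hypothesis q01 : 0 < q < 1.
Let q0 : 0 < q. Proof. by case/andP: q01. Qed.
Let q1 : q < 1. Proof. by case/andP: q01. Qed.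
Local Notation u := (den_re q).
Local Notation v := (den_im q).
Local Notation A := (amp q).

Lemma den_norm2E t : den_norm2 q t = (1 - q) ^+ 2 + 2 * q * (1 - cos t).
Proof.
rewrite /den_norm2 /den_re /den_im !exprMn sin2cos2; ring.
Qed.

(** Keeps [1 - q e^(it)] in the right half-plane, where [atan] gives the argument without a branch
    correction. *)
Lemma den_re_gt0 t : 0 < u t.
Proof. by rewrite /den_re subr_gt0 (le_lt_trans _ q1)// ler_piMr ?(ltW q0)// cos_le1. Qed.

Lemma den_norm2_ge t : (1 - q) ^+ 2 <= den_norm2 q t.
Proof.
by rewrite den_norm2E lerDl mulr_ge0 ?mulr_ge0 ?(ltW q0)// subr_ge0 cos_le1.
Qed.

Lemma den_norm2_gt0 t : 0 < den_norm2 q t.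
Proof. by rewrite (lt_le_trans _ (den_norm2_ge t))// exprn_gt0// subr_gt0. Qed.

Lemma amp_gt0 t : 0 < A t.
Proof. by rewrite invr_gt0 sqrtr_gt0 den_norm2_gt0. Qed.

Lemma amp_sqr t : A t ^+ 2 * (u t ^+ 2 + v t ^+ 2) = 1.
Proof.
rewrite /amp exprVn sqr_sqrtr ?ltW ?den_norm2_gt0// mulVf//.
by rewrite gt_eqF// den_norm2_gt0.
Qed.

Lemma amp_le t : A t <= (1 - q)^-1.
Proof.
rewrite /amp lef_pV2 ?posrE ?sqrtr_gt0 ?den_norm2_gt0 ?subr_gt0//.
by rewrite -(ger0_norm (ltW (_ : 0 < 1 - q))) ?subr_gt0// -sqrtr_sqr ler_wsqrtr// den_norm2_ge.
Qed.

Lemma amp_re_le t : `|A t * u t| <= 1.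
Proof.
rewrite -ler_sqr ?nnegrE// real_normK ?num_real//.
have := sqr_ge0 (A t * v t); rewrite expr1n -(amp_sqr t) !exprMn mulrDr; lra.
Qed.

Lemma amp_im_le t : `|A t * v t| <= 1.
Proof.
rewrite -ler_sqr ?nnegrE// real_normK ?num_real//.
have := sqr_ge0 (A t * u t); rewrite expr1n -(amp_sqr t) !exprMn mulrDr; lra.
Qed.

Lemma cos_phase t : cos (phase q t) = A t * u t.
Proof.
have u0 := den_re_gt0 t.
have -> : phase q t = atan (v t / u t) by [].
have E : 1 + (v t / u t) ^+ 2 = den_norm2 q t * (u t)^-1 ^+ 2.
  rewrite /den_norm2; field; lra.
rewrite cos_atan E sqrtrM ?ltW ?den_norm2_gt0// sqrtr_sqr.
by rewrite gtr0_norm ?invr_gt0// invfM invrK.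
Qed.

Lemma sin_phase t : sin (phase q t) = A t * v t.
Proof.
have u0 := den_re_gt0 t.
have c0 : cos (phase q t) != 0.
  by rewrite cos_phase gt_eqF// mulr_gt0// amp_gt0.
have : tan (phase q t) = v t / u t by rewrite /phase atanK.
move=> /(congr1 (fun z => z * cos (phase q t))).
rewrite /tan divfK// => ->; rewrite cos_phase; field; lra.
Qed.

Lemma amp_cos x t : A t * cos (x + phase q t) =
  A t ^+ 2 * (u t * cos x - v t * sin x).
Proof. by rewrite cosD cos_phase sin_phase; ring. Qed.

Definition amp_re t : R := A t ^+ 2 * u t.
Definition amp_im t : R := A t ^+ 2 * v t.

(** Real and imaginary parts of [1/z - 1/w = (w - z) / (z w)], where [1 / |z w| = A s * A t] and
    [w - z] is Lipschitz in each component. The factors [A u] and [A v] are the cosine and sine of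
    the phase, so each part is a sum of two products of size at most [2 * |s - t|]. *)
Lemma amp_re_im_lipschitz s t :
  `|amp_re s - amp_re t| <= 4 * (A s * A t * `|s - t|) /\
  `|amp_im s - amp_im t| <= 4 * (A s * A t * `|s - t|).
Proof.
have lu : `|u t - u s| <= `|s - t|.
  have -> : u t - u s = q * (cos s - cos t) by rewrite /den_re; ring.
  rewrite normrM gtr0_norm//.
  rewrite (le_trans _ (cos_lipschitz s t))// ler_piMl// ltW//.
have lv : `|v t - v s| <= `|s - t|.
  rewrite /den_im -mulrBr normrM gtr0_norm// distrC [leRHS]distrC.
  by rewrite (le_trans _ (sin_lipschitz t s))// distrC ler_piMl// ltW.
have As := amp_sqr s; have At := amp_sqr t.
have E1 : amp_re s - amp_re t = A s * A t *
   ((A s * u s * (A t * u t) - A s * v s * (A t * v t)) * (u t - u s) +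
    (A s * u s * (A t * v t) + A s * v s * (A t * u t)) * (v t - v s)).
  rewrite /amp_re -[A s ^+ 2 * u s]mulr1 -At -[A t ^+ 2 * u t]mulr1 -As; ring.
have E2 : amp_im s - amp_im t = A s * A t *
   ((A s * u s * (A t * v t) + A s * v s * (A t * u t)) * (u t - u s) -
    (A s * u s * (A t * u t) - A s * v s * (A t * v t)) * (v t - v s)).
  rewrite /amp_im -[A s ^+ 2 * v s]mulr1 -At -[A t ^+ 2 * v t]mulr1 -As; ring.
have b x1 x2 y1 y2 : `|x1| <= 1 -> `|x2| <= 1 -> `|y1| <= 1 -> `|y2| <= 1 ->
    `|x1 * x2 - y1 * y2| <= 2 :> R.
  move=> h1 h2 h3 h4; rewrite (le_trans (ler_normB _ _))// !normrM.
  have := mulr_ile1 (normr_ge0 x1) (normr_ge0 x2) h1 h2.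
  have := mulr_ile1 (normr_ge0 y1) (normr_ge0 y2) h3 h4; lra.
have c := b _ _ _ _ (amp_re_le s) (amp_re_le t) (amp_im_le s) (amp_im_le t).
have d : `|A s * u s * (A t * v t) + A s * v s * (A t * u t)| <= 2.
  have := b _ _ _ _ (amp_re_le s) (amp_im_le t) (amp_im_le s) _.
  by rewrite -[A s * v s * (A t * u t)]opprK -mulrN; apply; rewrite normrN amp_re_le.
have AA : 0 < A s * A t by rewrite mulr_gt0// amp_gt0.
have e x y z w : `|x| <= 2 -> `|y| <= 2 -> `|z| <= `|s - t| -> `|w| <= `|s - t| ->
    `|x * z + y * w| <= 4 * `|s - t|.
  move=> h1 h2 h3 h4; rewrite (le_trans (ler_normD _ _))// !normrM.
  have := ler_pM (normr_ge0 x) (normr_ge0 z) h1 h3.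
  have := ler_pM (normr_ge0 y) (normr_ge0 w) h2 h4; lra.
rewrite E1 E2 !normrM (gtr0_norm (amp_gt0 s)) (gtr0_norm (amp_gt0 t)).
rewrite [4 * _]mulrCA !ler_pM2l//; split; first exact: e c d lu lv.
by rewrite -mulrN; apply: (e _ _ _ _ d c lu _); rewrite normrN.
Qed.

(** Amplitude and phase move together: the wave is a combination of [amp_re] and [amp_im] with
    coefficients [cos x] and [- sin x], so the phase needs no estimate of its own. *)
Lemma amp_cos_lipschitz x s t :
  `|A s * cos (x + phase q s) - A t * cos (x + phase q t)| <=
  8 * (A s * A t * `|s - t|).
Proof.
rewrite !amp_cos; have [hu hv] := amp_re_im_lipschitz s t.
have -> : A s ^+ 2 * (u s * cos x - v s * sin x) -
    A t ^+ 2 * (u t * cos x - v t * sin x) =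
    (amp_re s - amp_re t) * cos x - (amp_im s - amp_im t) * sin x.
  by rewrite /amp_re /amp_im; ring.
rewrite (le_trans (ler_normB _ _))// !normrM.
have := ler_pM (normr_ge0 _) (normr_ge0 _) hu (cos_max x).
have := ler_pM (normr_ge0 _) (normr_ge0 _) hv (sin_max x); lra.
Qed.

(** Multiplying by [A s + A t] gives [A s ^ 2 - A t ^ 2], that is [(A s * A t) ^ 2] times a
    difference of [den_norm2]. In it the sums [u s + u t] and [v s + v t] are absorbed by
    [amp_re_le] and [amp_im_le]. *)
Lemma amp_lipschitz s t : `|A s - A t| <= 2 * (A s * A t * `|s - t|).
Proof.
have As := amp_sqr s; have At := amp_sqr t.
have As0 := amp_gt0 s; have At0 := amp_gt0 t.
have lu : `|u t - u s| <= `|s - t|.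
  have -> : u t - u s = q * (cos s - cos t) by rewrite /den_re; ring.
  rewrite normrM gtr0_norm//.
  rewrite (le_trans _ (cos_lipschitz s t))// ler_piMl// ltW//.
have lv : `|v t - v s| <= `|s - t|.
  rewrite /den_im -mulrBr normrM gtr0_norm// distrC [leRHS]distrC.
  by rewrite (le_trans _ (sin_lipschitz t s))// distrC ler_piMl// ltW.
have S0 : 0 < A s + A t by rewrite addr_gt0.
have E : (A s - A t) * (A s + A t) = A s * A t *
   (A t * (A s * u s) * (u t - u s) + A s * (A t * u t) * (u t - u s) +
    A t * (A s * v s) * (v t - v s) + A s * (A t * v t) * (v t - v s)).
  have -> : (A s - A t) * (A s + A t) = A s ^+ 2 - A t ^+ 2 by ring.
  by rewrite -[A s ^+ 2]mulr1 -At -[A t ^+ 2 in X in _ - X]mulr1 -As; ring.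
rewrite -(ler_pM2r S0) -[X in _ * X](gtr0_norm S0) -normrM E.
have b x y z : 0 <= x -> `|y| <= 1 -> `|z| <= `|s - t| -> `|x * y * z| <= x * `|s - t|.
  move=> x0 h1 h2; rewrite !normrM (ger0_norm x0) -mulrA ler_wpM2l//.
  by rewrite -[leRHS]mul1r ler_pM.
rewrite normrM gtr0_norm ?mulr_gt0//.
have -> : 2 * (A s * A t * `|s - t|) * (A s + A t) =
  A s * A t * (A t * `|s - t| + A s * `|s - t| + A t * `|s - t| + A s * `|s - t|).
  by ring.
rewrite ler_pM2l ?mulr_gt0//.
do 3 (apply: (le_trans (ler_normD _ _)); apply: lerD; last first;
  first by apply: b => //; rewrite ?amp_re_le ?amp_im_le ?ltW).
by apply: b => //; rewrite ?amp_re_le ?ltW.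
Qed.

(* Abel summation: [(1 - q e^(it)) * sum_j c_j e^(ijt)] has coefficients
   [c_(j+1) - q c_j], which are nonnegative when [c] decays no faster than
   [q^j]; their sum bounds the distance to [1]. *)
Lemma geometric_approx (c : nat -> R) m x t :
  c 0%N = 1 -> (forall j, 0 <= c j) -> (forall j, q * c j <= c j.+1) ->
  `|\sum_(j < m) c j * cos (j%:R * t + x) - A t * cos (x + phase q t)| <=
  4 * ((1 - q) * (\sum_(j < m) c j) - 1 + 2 * c m) * A t.
Proof.
move=> c0 cge0 cq.
set eta := (1 - q) * _ - 1 + _.
(* Used with g the cosine and the sine of [j t]. Summation by parts leaves [c 0 * g 0 = g 0], the
   nonnegative coefficients [c j.+1 - q * c j], and a boundary term at m. *)
have key (g : nat -> R) : (forall j, `|g j| <= 1) ->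
    `|\sum_(j < m) c j * (g j - q * g j.+1) - g 0%N| <= eta.
  move=> g1.
  have -> : \sum_(j < m) c j * (g j - q * g j.+1) - g 0%N =
      \sum_(j < m) (c j.+1 - q * c j) * g j.+1 - c m * g m.
    elim: m {eta} => [|m IH]; first by rewrite !big_ord0 c0 mul1r.
    by rewrite !big_ord_recr/= addrAC IH; ring.
  have -> : eta = \sum_(j < m) (c j.+1 - q * c j) + c m.
    rewrite /eta; elim: m {eta} => [|m IH].
      by rewrite !big_ord0 c0; ring.
    rewrite !big_ord_recr/= mulrDr.
    have := IH; set S := \sum_(i < m) c i; set T := \sum_(i < m) _; lra.
  apply: le_trans (ler_normB _ _) _; apply: lerD; last first.
    by rewrite normrM (ger0_norm (cge0 m)) ler_piMr.
  apply: le_trans (ler_norm_sum _ _ _) _; apply: ler_sum => j _.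
  by rewrite normrM ger0_norm ?subr_ge0// ler_piMr// subr_ge0.
pose C := \sum_(j < m) c j * cos (j%:R * t).
pose S := \sum_(j < m) c j * sin (j%:R * t).
(* [P + i Q = (1 - q e^(it)) (C + i S)], which has to be close to 1. *)
pose P := u t * C + v t * S; pose Q := u t * S - v t * C.
have hP : `|P - 1| <= eta.
  rewrite -(@cos0 R) -(mul0r t).
  rewrite (_ : P = \sum_(j < m) c j * (cos (j%:R * t) - q * cos (j.+1%:R * t))).
    by apply: (key (fun j => cos (j%:R * t))) => j; exact: cos_max.
  rewrite /P /C /S !mulr_sumr -big_split/=; apply: eq_bigr => j _.
  have -> : j.+1%:R * t = j%:R * t + t by rewrite -(natr1 j) mulrDl mul1r.
  by rewrite cosD /den_re /den_im; ring.
have hQ : `|Q| <= eta.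
  rewrite -[Q]subr0 -(@sin0 R) -(mul0r t).
  rewrite (_ : Q = \sum_(j < m) c j * (sin (j%:R * t) - q * sin (j.+1%:R * t))).
    by apply: (key (fun j => sin (j%:R * t))) => j; exact: sin_max.
  rewrite /Q /C /S !mulr_sumr -sumrB; apply: eq_bigr => j _.
  have -> : j.+1%:R * t = j%:R * t + t by rewrite -(natr1 j) mulrDl mul1r.
  by rewrite sinD /den_re /den_im; ring.
have eta0 : 0 <= eta by exact: le_trans hQ.
have At := amp_sqr t; have At0 := amp_gt0 t.
have -> : \sum_(j < m) c j * cos (j%:R * t + x) = cos x * C - sin x * S.
  rewrite /C /S !mulr_sumr -sumrB; apply: eq_bigr => j _.
  by rewrite cosD; ring.
have -> : cos x * C - sin x * S - A t * cos (x + phase q t) =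
    A t * ((A t * u t * cos x - A t * v t * sin x) * (P - 1) -
           (A t * v t * cos x + A t * u t * sin x) * Q).
  have -> : cos x * C - sin x * S = A t ^+ 2 *
      ((u t * cos x - v t * sin x) * P - (v t * cos x + u t * sin x) * Q).
    by rewrite -[LHS]mul1r -At /P /Q; ring.
  by rewrite amp_cos; ring.
have b y z : `|y| <= 1 -> `|z| <= 1 -> `|y * cos x| + `|z * sin x| <= 2.
  move=> y1 z1; rewrite !normrM.
  have := mulr_ile1 (normr_ge0 y) (normr_ge0 _) y1 (cos_max x).
  have := mulr_ile1 (normr_ge0 z) (normr_ge0 _) z1 (sin_max x); lra.
rewrite normrM (gtr0_norm At0) [leRHS]mulrC ler_pM2l//.
have -> : 4 * eta = 2 * eta + 2 * eta by ring.
apply: le_trans (ler_normB _ _) _; apply: lerD; rewrite normrM ler_pM//.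
  by apply: le_trans (ler_normB _ _) _; rewrite b// ?amp_re_le ?amp_im_le.
by apply: le_trans (ler_normD _ _) _; rewrite b// ?amp_re_le ?amp_im_le.
Qed.

End fixed_ratio.

(** The modulus of [1 / (d - i t)], the polar part at the origin of [1 / (1 - e^(-d + i t))]. *)
Definition rho (d t : R) : R := (Num.sqrt (d ^+ 2 + t ^+ 2))^-1.

Lemma expRN_bounds (d : R) : 0 < d ->
  [/\ 1 - d <= expR (- d), expR (- d) < 1 & d <= (1 + d) * (1 - expR (- d))].
Proof.
move=> d0; have h1 := expR_ge1Dx (- d); have h2 := expR_ge1Dx d.
have e0 := expR_gt0 d.
have h3 : expR d * expR (- d) = 1 by rewrite expRN mulfV// gt_eqF.
split; [lra| |].
  by rewrite expR_lt1 oppr_lt0.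
nra.
Qed.

(** With D and Z the reciprocals of the two terms, the difference is [(Z - D) / (D Z)]. As D and Z
    agree up to [3 Z^2] and [Z <= 10/3 D], the singularity cancels and the bound is uniform in d. *)
Lemma amp_rho (d t : R) : 0 < d <= 1 / 14 -> `|t| <= pi ->
  `|amp (expR (- d)) t - rho d t| <= 10.
Proof.
move=> /andP[d0 d1] tp; set q := expR (- d).
have [qlb q1 qub] := expRN_bounds d0; rewrite -/q in qlb q1 qub.
have q0 : 0 < q by exact: expR_gt0.
have q01 : 0 < q < 1 by rewrite q0 q1.
have Z2 : 0 < d ^+ 2 + t ^+ 2 by rewrite ltr_wpDr ?sqr_ge0// exprn_gt0.
have D2 := den_norm2_gt0 q01 t.
rewrite /amp /rho.
set D := Num.sqrt (den_norm2 q t); set Z := Num.sqrt _.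
have D0 : 0 < D by rewrite sqrtr_gt0.
have Z0 : 0 < Z by rewrite sqrtr_gt0.
have DE : D ^+ 2 = den_norm2 q t by rewrite sqr_sqrtr// ltW.
have ZE : Z ^+ 2 = d ^+ 2 + t ^+ 2 by rewrite sqr_sqrtr// ltW.
have tZ : `|t| <= Z.
  by rewrite -sqrtr_sqr ler_wsqrtr// lerDr sqr_ge0.
have dZ : d <= Z.
  by rewrite -(gtr0_norm d0) -sqrtr_sqr ler_wsqrtr// lerDl sqr_ge0.
have hre : `|den_re q t - d| <= Z ^+ 2.
  have c1 := one_sub_cos_le t; have c2 : 0 <= 1 - cos t by rewrite subr_ge0 cos_le1.
  rewrite ler_norml /den_re ZE; apply/andP; split; nra.
have him : `|den_im q t - t| <= 2 * Z ^+ 2.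
  have -> : den_im q t - t = q * (sin t - t) - (1 - q) * t by rewrite /den_im; ring.
  rewrite (le_trans (ler_normB _ _))// !normrM (gtr0_norm q0).
  rewrite (gtr0_norm (_ : 0 < 1 - q)) ?subr_gt0//.
  have s1 := sin_sub_id_le t.
  have h1 : q * `|sin t - t| <= Z ^+ 2.
    have := normr_ge0 (sin t - t); have := sqr_ge0 d; nra.
  have h2 : (1 - q) * `|t| <= Z * Z.
    by rewrite ler_pM// ?subr_ge0 ?(ltW q1)// (le_trans _ dZ)//; lra.
  by rewrite mulr_natl mulr2n lerD// expr2.
have dre0 := den_re_gt0 q01 t.
have dZ' : `|d| <= Z by rewrite gtr0_norm.
have reD : `|den_re q t| <= D.
  by rewrite -sqrtr_sqr ler_wsqrtr// lerDl sqr_ge0.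
have imD : `|den_im q t| <= D.
  by rewrite -sqrtr_sqr ler_wsqrtr// lerDr sqr_ge0.
have hDZ : `|D - Z| <= 3 * Z ^+ 2.
  have S0 : 0 < D + Z by rewrite addr_gt0.
  rewrite -(ler_pM2r S0) -[X in _ * X](gtr0_norm S0) -normrM.
  have -> : (D - Z) * (D + Z) = (den_re q t - d) * (den_re q t + d) +
      (den_im q t - t) * (den_im q t + t).
    by rewrite -subr_sqr DE ZE /den_norm2; ring.
  apply: le_trans (ler_normD _ _) _; rewrite !normrM.
  have := ler_pM (normr_ge0 _) (normr_ge0 _) hre
    (le_trans (ler_normD _ _) (lerD reD dZ')).
  have := ler_pM (normr_ge0 _) (normr_ge0 _) him
    (le_trans (ler_normD _ _) (lerD imD tZ)); lra.
(* The coefficient of [t^2] decides: [2 q / 18 >= 13/126 > 9/100], as [q >= 13/14]. *)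
have hZD : Z <= 10 / 3 * D.
  rewrite -ler_sqr ?nnegrE ?mulr_ge0// ?ltW// exprMn DE ZE den_norm2E.
  have c1 := one_sub_cos_ge tp.
  have h1 : 14 / 15 * d <= 1 - q by nra.
  have h2 : (14 / 15 * d) ^+ 2 <= (1 - q) ^+ 2.
    by rewrite ler_sqr ?nnegrE//; nra.
  nra.
have -> : D^-1 - Z^-1 = (Z - D) / (D * Z) by field; rewrite !gt_eqF.
rewrite normrM distrC normfV [`|D * Z|]gtr0_norm ?mulr_gt0//.
rewrite ler_pdivrMr ?mulr_gt0//.
apply: le_trans hDZ _; rewrite expr2 !mulrA ler_pM2r//; lra.
Qed.

End geometric.

(** * Integrals of periodic functions *)

Section lebesgue_affine.
Context {R : realType}.
Local Notation mu := (@lebesgue_measure R).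
Local Open Scope ereal_scope.

Lemma measurable_affine (a c : R) :
  measurable_fun [set: R] (fun x : R => a * x + c)%R.
Proof. by apply: measurable_funD => //; apply: measurable_funM. Qed.

(** By uniqueness of Lebesgue measure: a times the image of [mu] under [x -> a x + c] agrees with
    [mu] on half-open intervals. *)
Lemma ge0_integral_affine (a c : R) (f : R -> \bar R) : (0 < a)%R ->
  measurable_fun [set: R] f -> (forall x, 0 <= f x) ->
  \int[mu]_x f (a * x + c)%R = (a^-1)%:E * \int[mu]_x f x.
Proof.
move=> a0 mf f0.
have mphi : measurable_fun [set: measurableTypeR R]
    (fun x => a * x + c : measurableTypeR R)%R by exact: measurable_affine.
(* Repackages the pushforward as a measure; only the equality of set functions is kept. *)
have [pf pfE] : exists nu : {measure set (measurableTypeR R) -> \bar R},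
    nu = pushforward mu (fun x : R => a * x + c)%R :> (set _ -> \bar R).
  by exists (measure_function_pushforward__canonical__measure_function_Measure mu mphi).
pose nu := mscale (NngNum (ltW a0)) pf.
have E A : measurable A -> mu A = nu A.
  apply: lebesgue_measure_unique => _ [[x y] _ <-].
  rewrite /= /mscale /= pfE /pushforward.
  have -> : (fun x : R => a * x + c)%R @^-1` `]x, y] = `]((x - c) / a)%R, ((y - c) / a)%R]%classic.
    apply/seteqP; split => z /=; rewrite !in_itv/= ltr_pdivrMr// ler_pdivlMr//.
      by rewrite (mulrC z) ltrBlDr lerBrDr.
    by rewrite (mulrC z) ltrBlDr lerBrDr.
  rewrite !lebesgue_measure_itv/= !lte_fin ltr_pM2r ?invr_gt0// ltrD2r.
  case: ifPn => // xy; last by rewrite mule0.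
  rewrite -!EFinD -EFinM; congr EFin; field; lra.
have -> : \int[mu]_x f x = \int[nu]_x f x.
  by apply: eq_measure_integral => A mA _; exact: E.
rewrite ge0_integral_mscale//= (_ : \int[pf]_x f x = \int[mu]_x f (a * x + c)%R).
  by rewrite muleA -EFinM mulVf ?gt_eqF// mul1e.
by rewrite pfE (ge0_integral_pushforward mphi)// preimage_setT.
Qed.

Lemma ge0_integral_itv_affine (a c u v : R) (f : R -> \bar R) : (0 < a)%R ->
  measurable_fun [set: R] f -> (forall x, 0 <= f x) ->
  \int[mu]_(x in `[u, v[) f (a * x + c)%R =
  (a^-1)%:E * \int[mu]_(x in `[(a * u + c)%R, (a * v + c)%R[) f x.
Proof.
move=> a0 mf f0.
rewrite integral_mkcond [in RHS]integral_mkcond -(@ge0_integral_affine a c)//.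
- apply: eq_integral => x _; rewrite /patch !mem_setE !in_itv/=.
  by rewrite lerD2r ltrD2r ler_pM2l// ltr_pM2l.
- by apply/(measurable_restrictT _ _).1 => //; exact: measurable_funTS.
- by move=> x; rewrite patchE; case: ifP.
Qed.

Lemma ge0_integral_itvco_split (u v w : R) (f : R -> \bar R) :
  (u <= v)%R -> (v <= w)%R ->
  measurable_fun [set: R] f -> (forall x, 0 <= f x) ->
  \int[mu]_(x in `[u, w[) f x =
  \int[mu]_(x in `[u, v[) f x + \int[mu]_(x in `[v, w[) f x.
Proof.
move=> uv vw mf f0.
rewrite -ge0_integral_setU//=.
- by rewrite -itv_bndbnd_setU ?bnd_simp.
- exact: measurable_funTS.
- apply/disj_setPS => x []/=; rewrite !in_itv/= => /andP[_ xv] /andP[vx _].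
  by move: (lt_le_trans xv vx); rewrite ltxx.
Qed.

Section periodic_integrals.
Variable T : R.
Hypothesis T0 : (0 < T)%R.

Lemma periodic_int {U : Type} (f : R -> U) (m : int) x :
  (forall y, f (y + T)%R = f y) -> f (x + m%:~R * T)%R = f x.
Proof.
move=> pf; have h k y : f (y + k%:R * T)%R = f y.
  elim: k y => [|k IH] y; first by rewrite mul0r addr0.
  by rewrite -natr1 mulrDl mul1r addrA pf.
case: m => k; first exact: h.
by rewrite NegzE mulrNz mulNr -(h k.+1 (_ - _)%R) subrK.
Qed.

Lemma ge0_integral_periodic (f : R -> \bar R) (c : R) :
  measurable_fun [set: R] f -> (forall x, 0 <= f x) -> (forall y, f (y + T)%R = f y) ->
  \int[mu]_(x in `[c, (c + T)%R[) f x = \int[mu]_(x in `[0%R, T[) f x.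
Proof.
move=> mf f0 pf.
(* Reduce c to d in [[0, T[], split [[d, d + T[] at T, and move the second piece back to [[0,
   d[]. *)
pose m := Num.floor (c / T); pose d := (c - m%:~R * T)%R.
have /andP[d0 dT] : (0 <= d < T)%R.
  have /andP[h1 h2] := floor_itv (c / T).
  rewrite /d subr_ge0 ltrBlDr -{2}[T]mul1r -mulrDl addrC -ler_pdivlMr// -ltr_pdivrMr//.
  by rewrite h1/=; move: h2; rewrite intrD.
have shift (k : int) u v :
    \int[mu]_(x in `[u, v[) f x =
    \int[mu]_(x in `[(u + k%:~R * T)%R, (v + k%:~R * T)%R[) f x.
  have := @ge0_integral_itv_affine 1%R (k%:~R * T)%R u v f ltr01 mf f0.
  rewrite !mul1r invr1 mul1e => <-; apply: eq_integral => x _.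
  by rewrite mul1r periodic_int.
rewrite (shift (- m)%R) !mulrNz !mulNr -/d addrAC -/d.
rewrite (@ge0_integral_itvco_split d T) ?(ltW dT)//; last by rewrite lerDr.
rewrite (@ge0_integral_itvco_split 0%R d T) ?(ltW dT)// addeC; congr (_ + _).
by rewrite (shift 1%R 0%R d) !mul1r add0r.
Qed.

Lemma ge0_integral_periodic_shift (f : R -> \bar R) (c : R) :
  measurable_fun [set: R] f -> (forall x, 0 <= f x) ->
  (forall x, f (x + T)%R = f x) ->
  \int[mu]_(x in `[0%R, T[) f (x + c)%R = \int[mu]_(x in `[0%R, T[) f x.
Proof.
move=> mf f0 pf; have := @ge0_integral_itv_affine 1%R c 0%R T f ltr01 mf f0.
rewrite !mul1r invr1 mul1e add0r addrC ge0_integral_periodic// => <-.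
by apply: eq_integral => x _; rewrite mul1r.
Qed.

(** The profile [psi k] may change with the cell. Substituting [u = n t] stretches each cell to one
    full period, whose position is irrelevant by periodicity. *)
Lemma ge0_integral_cells (n : nat) (F : R -> \bar R) (psi : nat -> R -> \bar R) :
  (0 < n)%N -> measurable_fun [set: R] F -> (forall x, 0 <= F x) ->
  (forall k, measurable_fun [set: R] (psi k)) -> (forall k x, 0 <= psi k x) ->
  (forall k x, psi k (x + T)%R = psi k x) ->
  (forall k t, (k < n)%N -> (k%:R * (T / n%:R) <= t < k.+1%:R * (T / n%:R))%R ->
    F t = psi k (n%:R * t)%R) ->
  \int[mu]_(t in `[0%R, T[) F t =
  \sum_(k < n) (n%:R^-1)%:E * \int[mu]_(t in `[0%R, T[) psi k t.
Proof.
move=> n0 mF F0 mpsi psi0 ppsi HF.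
have nR0 : (0 < n%:R :> R)%R by rewrite ltr0n.
have w0 : (0 < T / n%:R)%R by rewrite divr_gt0.
suff H m : (m <= n)%N -> \int[mu]_(t in `[0%R, (m%:R * (T / n%:R))%R[) F t =
    \sum_(k < m) (n%:R^-1)%:E * \int[mu]_(t in `[0%R, T[) psi k t.
  by rewrite -H// mulrCA mulfV ?gt_eqF// mulr1.
elim: m => [_|m IH mn].
  by rewrite mul0r set_itvco0 integral_set0 big_ord0.
rewrite (@ge0_integral_itvco_split 0%R (m%:R * (T / n%:R)))//; last 2 first.
- by rewrite mulr_ge0// ltW.
- by rewrite ler_pM2r// ler_nat.
rewrite IH ?(ltnW mn)// big_ord_recr/=; congr (_ + _).
transitivity (\int[mu]_(t in `[(m%:R * (T / n%:R))%R, (m.+1%:R * (T / n%:R))%R[)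
    psi m (n%:R * t + 0)%R).
  by apply: eq_integral => t; rewrite inE/= in_itv/= addr0 => ht; exact: HF.
rewrite (@ge0_integral_itv_affine n%:R 0%R)// !addr0.
have -> : (n%:R * (m.+1%:R * (T / n%:R)) = n%:R * (m%:R * (T / n%:R)) + T)%R.
  by rewrite -natr1; field; rewrite gt_eqF.
by rewrite ge0_integral_periodic.
Qed.

End periodic_integrals.

Lemma ge0_integral_mrestr (D : set R) (mD : measurable D) (f : R -> \bar R) :
  measurable_fun [set: R] f -> (forall x, 0 <= f x) ->
  \int[mrestr mu mD]_x f x = \int[mu]_(x in D) f x.
Proof.
move=> mf f0.
rewrite -(setUv D) ge0_integral_setU//=.
- rewrite [X in _ + X](_ : _ = 0) ?adde0.
    by apply: eq_measure_integral => A mA AD; rewrite /= /mrestr setIidl.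
  apply: null_set_integral.
  + exact: measurableC.
  + by apply: measurable_funTS.
  + by rewrite /= /mrestr setICl measure0.
- exact: measurableC.
- by apply: measurable_funTS.
- by apply/disj_setPS; rewrite setICr.
Qed.

End lebesgue_affine.

(** * Fourier sums of cosine series *)

Section bounded_measurable.
Context {R : realType}.
Implicit Types f g phi : R -> R.
Local Notation mu := (@lebesgue_measure R).

(** The working class for kernels, trigonometric polynomials and waves: closed under ring operations
    and affine substitution, and a multiplier of integrable functions on compact intervals. *)
Definition bounded_measurable f :=
  measurable_fun [set: R] f /\ exists M, forall x, `|f x| <= M.

Lemma bounded_measurable_cst c : bounded_measurable (fun=> c).
Proof. by split; [exact: measurable_cst|exists `|c|]. Qed.

Lemma bounded_measurableD f g : bounded_measurable f -> bounded_measurable g ->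
  bounded_measurable (fun x => f x + g x).
Proof.
move=> [mf [M hM]] [mg [N hN]]; split; first exact: measurable_funD.
by exists (M + N) => x; rewrite (le_trans (ler_normD _ _))// lerD.
Qed.

Lemma bounded_measurableM f g : bounded_measurable f -> bounded_measurable g ->
  bounded_measurable (fun x => f x * g x).
Proof.
move=> [mf [M hM]] [mg [N hN]]; split; first exact: measurable_funM.
by exists (M * N) => x; rewrite normrM ler_pM.
Qed.

Lemma bounded_measurableB f g : bounded_measurable f -> bounded_measurable g ->
  bounded_measurable (fun x => f x - g x).
Proof.
move=> bf [mg [N hN]]; apply: bounded_measurableD => //; split.
  exact: measurableT_comp.
by exists N => x; rewrite normrN.
Qed.

Lemma bounded_measurable_sum (F : nat -> R -> R) m n :
  (forall k, bounded_measurable (F k)) ->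
  bounded_measurable (fun x => \sum_(m <= k < n) F k x).
Proof.
move=> bF; elim: n => [|n IH].
  by under eq_fun do rewrite big_geq//; exact: bounded_measurable_cst.
have [mn|nm] := leqP m n; last first.
  by under eq_fun do rewrite big_geq//; exact: bounded_measurable_cst.
by under eq_fun do rewrite big_nat_recr//=; exact: bounded_measurableD.
Qed.

Lemma bounded_measurable_affine f a c : bounded_measurable f ->
  bounded_measurable (fun x => f (a * x + c)).
Proof.
move=> [mf [M hM]]; split; last by exists M.
by apply: measurableT_comp => //; exact: measurable_affine.
Qed.

Lemma bounded_measurable_cos a c : bounded_measurable (fun x => cos (a * x + c)).
Proof.
apply: (bounded_measurable_affine a c); split.
  by apply: continuous_measurable_fun; exact: continuous_cos.
by exists 1; exact: cos_max.
Qed.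

Lemma bounded_measurable_integrable f a b : bounded_measurable f ->
  mu.-integrable `[a, b] (EFin \o f).
Proof.
move=> [mf [M hM]]; apply: measurable_bounded_integrable => //.
- by rewrite /= lebesgue_measure_itv/=; case: ifP => _ //=; exact: ltry.
- exact: measurable_funTS.
- by exists M; split; rewrite ?num_real// => y My x _/=; rewrite (le_trans (hM x))// ltW.
Qed.

Lemma bounded_measurable_mul_integrable f phi a b : bounded_measurable f ->
  mu.-integrable `[a, b] (EFin \o phi) ->
  mu.-integrable `[a, b] (EFin \o (fun x => f x * phi x)).
Proof.
move=> [mf [M hM]] iphi.
apply: (@integrableMr _ _ _ mu `[a, b] _ f (EFin \o phi)) => //.
  exact: measurable_funTS.
by exists M; split; rewrite ?num_real// => y My x _/=; rewrite (le_trans (hM x))// ltW.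
Qed.

Lemma Rintegral_norm_le f phi a b c :
  bounded_measurable f -> mu.-integrable `[a, b] (EFin \o phi) ->
  (forall x, `|f x| <= c) ->
  `|\int[mu]_(x in `[a, b]) (f x * phi x)| <=
    c * \int[mu]_(x in `[a, b]) `|phi x|.
Proof.
move=> bf iphi fc.
have i1 := bounded_measurable_mul_integrable bf iphi.
have i2 : mu.-integrable `[a, b] (EFin \o (fun x => `|phi x|)).
  by have := integrable_abse iphi; apply: eq_integrable => // x _.
apply: le_trans (le_normr_Rintegral _ i1) _ => //.
rewrite -RintegralZl//; apply: le_Rintegral => //.
- by have := integrable_abse i1; apply: eq_integrable => // x _.
- have := integrableZl _ c i2; move=> /(_ (measurable_itv _)).
  by apply: eq_integrable.
- by move=> x _; rewrite normrM ler_wpM2r.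
Qed.

End bounded_measurable.

(** * Fourier coefficients of uniform limits of trigonometric polynomials *)

Section fourier_coefficients.
Context {R : realType}.
Implicit Types (f : R -> R) (u v w : nat -> R) (c d a : R) (j k m n : nat).
Local Notation mu := (@lebesgue_measure R).
Local Notation I f := (\int[mu]_(t in `[- pi, pi]) f t).

Lemma sin_natr_pi k : sin (k%:R * pi) = 0 :> R.
Proof.
elim: k => [|k IH]; first by rewrite mul0r sin0.
by rewrite -natr1 mulrDl mul1r sinDpi IH oppr0.
Qed.

(** The condition on [sin (c * pi)] encodes an integer frequency and admits negative ones such as
    [j - k] without casts. *)
Lemma integral_cos_affine c d : c != 0 -> sin (c * pi) = 0 ->
  I (fun t => cos (c * t + d)) = 0.
Proof.
move=> c0 sc.
have pp : - pi < pi :> R by have := @pi_gt0 R; lra.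
pose G t : R := sin (c * t + d) / c.
have dG (t : R) : is_derive t (1 : R) G (cos (c * t + d)).
  rewrite /G; apply: is_derive_eq.
  by rewrite ?scaler1 /GRing.scale/=; field.
rewrite /Rintegral (@continuous_FTC2 _ _ G)//=.
- by rewrite /G mulrN [sin (- _ + _)]sinD [sin (c * pi + _)]sinD sinN cosN sc; lra.
- apply: continuous_subspaceT => t.
  apply: continuous_comp; last exact: continuous_cos.
  by apply: continuousD; [apply: continuousM|]; exact: cvg_cst || exact: cvg_id.
- split.
  + by move=> t _; case: (dG t).
  + apply: cvg_at_right_filter; apply: differentiable_continuous.
    by apply/derivable1_diffP; case: (dG (- pi)).
  + apply: cvg_at_left_filter; apply: differentiable_continuous.
    by apply/derivable1_diffP; case: (dG pi).
- by move=> t _; rewrite derive1E; case: (dG t).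
Qed.

(** The free phases cover all orthogonality relations at once: a sine is a cosine with phase
    [- pi / 2]. *)
Lemma integral_cos_mul_cos j k c d : (0 < j)%N ->
  I (fun t => cos (j%:R * t + c) * cos (k%:R * t + d)) =
  if j == k then pi * cos (c - d) else 0.
Proof.
move=> j0.
have E (t : R) : cos (j%:R * t + c) * cos (k%:R * t + d) =
    2^-1 * (cos ((j%:R - k%:R) * t + (c - d)) + cos ((j%:R + k%:R) * t + (c + d))).
  have -> : (j%:R - k%:R) * t + (c - d) = (j%:R * t + c) - (k%:R * t + d) by ring.
  have -> : (j%:R + k%:R) * t + (c + d) = (j%:R * t + c) + (k%:R * t + d) by ring.
  by rewrite [cos (_ - _)]cosB [cos (j%:R * t + c + _)]cosD; field.
under eq_Rintegral do rewrite E.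
have i1 c' d' := bounded_measurable_integrable (- pi) pi (@bounded_measurable_cos R c' d').
rewrite RintegralZl//; last first.
  exact: (bounded_measurable_integrable _ _
    (bounded_measurableD (bounded_measurable_cos _ _) (bounded_measurable_cos _ _))).
rewrite RintegralD//.
rewrite [X in _ + X]integral_cos_affine ?addr0; last 2 first.
- by rewrite -natrD pnatr_eq0 addn_eq0 negb_and -lt0n j0.
- by rewrite -natrD sin_natr_pi.
case: eqVneq => [<-|jk].
  rewrite subrr; under eq_Rintegral do rewrite mul0r add0r.
  rewrite Rintegral_cst//= lebesgue_measure_itv/= lte_fin.
  have p0 := @pi_gt0 R.
  rewrite ifT ?fine_cst/=; last by lra.
  by rewrite opprK; field.
rewrite integral_cos_affine ?mulr0//.
- by rewrite subr_eq0 eqr_nat.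
- by rewrite mulrBl sinB !sin_natr_pi mul0r mulr0 subrr.
Qed.

(** Harmonics strictly below m, with a the mean itself; hence the index [m.+1] and the coefficient
    [2 * a] when it is compared with [fourier_sum]. *)
Definition trig_poly a u v m (x : R) : R :=
  a + \sum_(1 <= k < m) (u k * cos (k%:R * x) + v k * sin (k%:R * x)).

Lemma bounded_measurable_trig_term x y k :
  bounded_measurable (fun t : R => x * cos (k%:R * t) + y * sin (k%:R * t)).
Proof.
apply: bounded_measurableD; apply: bounded_measurableM;
  try exact: bounded_measurable_cst.
  by have := @bounded_measurable_cos R k%:R 0; under eq_fun do rewrite addr0.
have := @bounded_measurable_cos R k%:R (- (pi / 2)).
by under eq_fun do rewrite cosBpihalf.
Qed.

Lemma bounded_measurable_trig_poly a u v m : bounded_measurable (trig_poly a u v m).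
Proof.
apply: bounded_measurableD; first exact: bounded_measurable_cst.
by apply: (@bounded_measurable_sum _ (fun k t => _)) => k; exact: bounded_measurable_trig_term.
Qed.

Lemma integral_trig_poly_mul_cos a u v m k d :
  I (fun t => trig_poly a u v m t * cos (k%:R * t + d)) =
  (if k == 0%N then 2 * pi * a * cos d else 0) +
  (if (0 < k < m)%N then pi * (u k * cos d - v k * sin d) else 0).
Proof.
have bc := @bounded_measurable_cos R k%:R d.
have p0 := @pi_gt0 R.
have ba : bounded_measurable (fun t : R => a * cos (k%:R * t + d)).
  by apply: bounded_measurableM => //; exact: bounded_measurable_cst.
have bt j := bounded_measurableM (bounded_measurable_trig_term (u j) (v j) j) bc.
have E0 : I (fun t => a * cos (k%:R * t + d)) =
    if k == 0%N then 2 * pi * a * cos d else 0.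
  rewrite RintegralZl//; last exact: bounded_measurable_integrable.
  case: eqVneq => [->|k0].
    under eq_Rintegral do rewrite mul0r add0r.
    rewrite Rintegral_cst//= lebesgue_measure_itv/= lte_fin.
    rewrite ifT ?fine_cst/=; last by lra.
    by rewrite opprK; ring.
  by rewrite integral_cos_affine ?mulr0// ?pnatr_eq0// sin_natr_pi.
have E1 j : (0 < j)%N -> I (fun t => (u j * cos (j%:R * t) + v j * sin (j%:R * t)) *
     cos (k%:R * t + d)) = if j == k then pi * (u j * cos d - v j * sin d) else 0.
  move=> j0.
  have Et (t : R) : (u j * cos (j%:R * t) + v j * sin (j%:R * t)) * cos (k%:R * t + d) =
    u j * (cos (j%:R * t + 0) * cos (k%:R * t + d)) +
    v j * (cos (j%:R * t + - (pi / 2)) * cos (k%:R * t + d)).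
    by rewrite cosBpihalf addr0; ring.
  under eq_Rintegral do rewrite Et.
  have b2 c' := bounded_measurableM (@bounded_measurable_cos R j%:R c') bc.
  have b3 z c' := bounded_measurableM (bounded_measurable_cst z) (b2 c').
  rewrite RintegralD//; try exact: (bounded_measurable_integrable _ _ (b3 _ _)).
  rewrite !RintegralZl//; try exact: (bounded_measurable_integrable _ _ (b2 _)).
  rewrite !integral_cos_mul_cos//; case: eqP => _; last by rewrite !mulr0 addr0.
  have -> : cos (- (pi / 2) - d) = - sin d by rewrite -opprD cosN addrC cosDpihalf.
  by rewrite sub0r cosN; ring.
elim: m => [|m IH].
  rewrite ltn0 andbF addr0 -E0; apply: eq_Rintegral => t _.
  by rewrite /trig_poly big_geq// addr0.
have [m0|m0] := posnP m.
  rewrite m0 (_ : (0 < k < 1)%N = false) ?addr0 -?E0; last by case: (k).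
  by apply: eq_Rintegral => t _; rewrite /trig_poly big_geq// addr0.
have Es (t : R) : trig_poly a u v m.+1 t * cos (k%:R * t + d) =
  trig_poly a u v m t * cos (k%:R * t + d) +
  (u m * cos (m%:R * t) + v m * sin (m%:R * t)) * cos (k%:R * t + d).
  by rewrite /trig_poly big_nat_recr//= addrA mulrDl.
under eq_Rintegral do rewrite Es.
rewrite RintegralD//; last 2 first.
- exact: (bounded_measurable_integrable _ _
    (bounded_measurableM (bounded_measurable_trig_poly _ _ _ _) bc)).
- exact: (bounded_measurable_integrable _ _ (bt m)).
rewrite IH E1// ltnS -addrA; congr (_ + _).
case: (ltngtP k m) => [km|mk|km]; rewrite ?andbT ?andbF ?addr0 ?add0r//=.
by rewrite km m0.
Qed.

Lemma integral_uniform_limit_mul_cos f a u v (eta : nat -> R) k d :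
  bounded_measurable f -> (forall m x, `|f x - trig_poly a u v m x| <= eta m) ->
  eta m @[m --> \oo] --> (0 : R) ->
  I (fun t => f t * cos (k%:R * t + d)) =
  (if k == 0%N then 2 * pi * a * cos d else 0) +
  (if (0 < k)%N then pi * (u k * cos d - v k * sin d) else 0).
Proof.
move=> bf feta eta0; set rhs := (X in _ = X).
have bc := @bounded_measurable_cos R k%:R d.
have ic := bounded_measurable_integrable (- pi) pi bc.
pose B := I (fun t => `|cos (k%:R * t + d)|).
apply/eqP; rewrite -subr_eq0 -normr_le0; apply/ler_addgt0Pr => e e0; rewrite add0r.
have : eta m * B @[m --> \oo] --> (0 : R).
  by rewrite -(mul0r B); apply: cvgMl.
move=> /cvgrPdist_lt /(_ _ e0) [N _ HN].
(* Beyond N the error is below e; beyond k the polynomial already contains harmonic k, so its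
   integral equals [rhs] exactly. *)
pose m := maxn N k.+1.
have := HN m (leq_maxl _ _); rewrite /= sub0r normrN => /ltW; apply: le_trans.
apply: le_trans _ (ler_norm _).
have -> : rhs = I (fun t => trig_poly a u v m t * cos (k%:R * t + d)).
  by rewrite integral_trig_poly_mul_cos (leq_maxr N k.+1 : (k < m)%N) andbT.
rewrite -RintegralB//; last 2 first.
- exact: (bounded_measurable_integrable _ _ (bounded_measurableM bf bc)).
- exact: (bounded_measurable_integrable _ _
    (bounded_measurableM (bounded_measurable_trig_poly _ _ _ _) bc)).
under eq_Rintegral do rewrite -mulrBl.
apply: (@Rintegral_norm_le R (fun t => f t - trig_poly a u v m t)) => //.
exact: bounded_measurableB (bounded_measurable_trig_poly _ _ _ _).
Qed.

Lemma fourier_sum_uniform_limit f a u v (eta : nat -> R) m x :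
  bounded_measurable f -> (forall m x, `|f x - trig_poly a u v m x| <= eta m) ->
  eta m @[m --> \oo] --> (0 : R) ->
  fourier_sum m f x = trig_poly a u v m.+1 x.
Proof.
move=> bf feta eta0.
have p0 := @pi_gt0 R.
have H k d := integral_uniform_limit_mul_cos k d bf feta eta0.
have HC k : fourier_cos f k = if k == 0%N then 2 * a else u k.
  rewrite /fourier_cos; have := H k 0.
  under eq_Rintegral do rewrite addr0.
  move=> ->; rewrite cos0 sin0; case: k => [|k] /=; field; lra.
have HS k : (0 < k)%N -> fourier_sin f k = v k.
  move=> k0; rewrite /fourier_sin; have := H k (- (pi / 2)).
  under eq_Rintegral do rewrite cosBpihalf.
  move=> ->; rewrite cosN sinN cos_pihalf sin_pihalf k0 eqn0Ngt k0/=; field; lra.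
rewrite /fourier_sum /trig_poly HC/= mulrAC mulfV ?mul1r//; congr (_ + _).
by apply: eq_big_nat => k /andP[k0 _]; rewrite HC HS// eqn0Ngt k0.
Qed.

End fourier_coefficients.

(** * Absolutely convergent cosine series and their convolutions *)

Section cosine_series.
Context {R : realType}.
Local Notation mu := (@lebesgue_measure R).

Lemma series_tail_le (g w : nat -> R) : (forall k, `|g k| <= w k) ->
  cvgn (series w) -> cvgn (series g) /\
  forall m, `|limn (series g) - series g m| <= limn (series w) - series w m.
Proof.
move=> gw cw.
have w0 k : 0 <= w k by rewrite (le_trans _ (gw k)).
have cg : cvgn (series g).
  by apply: normed_cvg; apply: (@series_le_cvg _ _ w) => // k /=; exact: normr_ge0.
split => // m.
have H : `|series g M - series g m| @[M --> \oo] --> `|limn (series g) - series g m|.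
  by apply: cvg_norm; apply: cvgB => //; exact: cvg_cst.
rewrite -(cvg_lim _ H)//; apply: limr_le; first by apply/cvg_ex; eexists; exact: H.
exists m => // M /= mM.
have nd : nondecreasing_seq (series w) by apply: nondecreasing_series => k _ _; exact: w0.
apply: (@le_trans _ _ (series w M - series w m)); last first.
  by rewrite lerD2r; exact: nondecreasing_cvgn_le.
rewrite !sub_series_geq//; apply: le_trans (ler_norm_sum _ _ _) _.
exact: ler_sum.
Qed.

Variable w : nat -> R.
Hypotheses (w0 : forall k, 0 <= w k) (cw : cvgn (series w)).

(** Convertible to [poisson_kernel] for the weights [expcoef al r] and [b = beta * pi / 2]. *)
Definition cos_series (b t : R) : R :=
  limn (fun m => \sum_(1 <= k < m) w k * cos (k%:R * t - b)).

Definition series_tail (m : nat) : R := limn (series w) - series w m.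

Lemma series_tail_cvg0 : series_tail m @[m --> \oo] --> (0 : R).
Proof.
by rewrite -(subrr (limn (series w))); apply: cvgB => //; exact: cvg_cst.
Qed.

Lemma cos_series_approx b t m :
  `|cos_series b t - \sum_(1 <= k < m) w k * cos (k%:R * t - b)| <= series_tail m.
Proof.
(* The sum starts at 1 and [series] at 0, so the term of index 0 is set to 0. *)
pose g k := if k == 0%N then 0 else w k * cos (k%:R * t - b).
have gE : (fun m => \sum_(1 <= k < m) w k * cos (k%:R * t - b)) = series g.
  apply/funext; elim => [|[_|k IH]]; first by rewrite /series/= !big_geq.
    by rewrite /series/= big_geq// big_nat1.
  by rewrite big_nat_recr//= IH /series/= [RHS]big_nat_recr.
have gw k : `|g k| <= w k.
  rewrite /g; case: ifP => _; first by rewrite normr0.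
  by rewrite normrM ger0_norm// ler_piMr// cos_max.
rewrite /cos_series gE -[X in _ - X]/((fun m => \sum_(1 <= k < m) w k * cos (k%:R * t - b)) m) gE.
exact: (series_tail_le gw cw).2.
Qed.

Lemma cos_series_cvg b t :
  (fun m => \sum_(1 <= k < m) w k * cos (k%:R * t - b)) @ \oo --> cos_series b t.
Proof.
apply/cvgrPdist_lt => e e0.
move/cvgrPdist_lt: series_tail_cvg0 => /(_ _ e0) [N _ HN]; exists N => // m /HN.
rewrite /= sub0r normrN; apply: le_lt_trans.
by rewrite (le_trans (cos_series_approx b t m))// ler_norm.
Qed.

Lemma cos_series_periodic b : periodic (cos_series b) (2 * pi).
Proof.
move=> t; rewrite /cos_series.
suff -> : (fun m => \sum_(1 <= k < m) w k * cos (k%:R * (t + 2 * pi) - b)) =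
    (fun m => \sum_(1 <= k < m) w k * cos (k%:R * t - b)) by [].
apply/funext => m; apply: eq_bigr => k _; congr (_ * _).
have -> : k%:R * (t + 2 * pi) - b = (k%:R * t - b) + pi *+ 2 *+ k.
  by rewrite -(mulr_natl _ k) -(mulr_natl pi 2); ring.
by rewrite (periodicn (@cosD2pi R)).
Qed.

Lemma bounded_measurable_cos_series b : bounded_measurable (cos_series b).
Proof.
split.
  refine (@measurable_fun_cvg _ _ R setT
    (fun (m : nat) (t : R) => \sum_(1 <= k < m) w k * cos (k%:R * t - b)) _ _ _).
    move=> m; apply: (proj1 (@bounded_measurable_sum _ (fun k t => _) _ _ _)) => k.
    apply: bounded_measurableM; first exact: bounded_measurable_cst.
    exact: bounded_measurable_cos.
  by move=> t _; exact: cos_series_cvg.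
exists (series_tail 0) => t; have := cos_series_approx b t 0.
by rewrite big_geq// subr0.
Qed.

Section convolution.
Variables (phi : R -> R) (b a : R).
Hypothesis iphi : mu.-integrable `[- pi, pi] (EFin \o phi).

Let f x := a / 2 + pi^-1 * \int[mu]_(t in `[- pi, pi]) (cos_series b (x - t) * phi t).
Let U k := pi^-1 * (w k * \int[mu]_(t in `[- pi, pi]) (cos (k%:R * t + b) * phi t)).
Let V k := pi^-1 * (w k * \int[mu]_(t in `[- pi, pi]) (cos (k%:R * t + (b - pi / 2)) * phi t)).

Let partial_integral m x :
  trig_poly (a / 2) U V m x = a / 2 + pi^-1 * \int[mu]_(t in `[- pi, pi])
    ((\sum_(1 <= k < m) w k * cos (k%:R * (x - t) - b)) * phi t).
Proof.
have bmc k c := @bounded_measurable_cos R k c.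
have bmF k : bounded_measurable (fun t : R => w k * cos (k%:R * (x - t) - b)).
  apply: bounded_measurableM; first exact: bounded_measurable_cst.
  have := bmc (- k%:R) (k%:R * x - b); congr bounded_measurable.
  by apply/funext => t; congr cos; ring.
rewrite /trig_poly; congr (_ + _).
elim: m => [|m IH].
  rewrite !big_geq//; under eq_Rintegral do rewrite big_geq// mul0r.
  by rewrite Rintegral_cst// mul0r mulr0.
have [m0|m0] := posnP m.
  rewrite m0 !big_geq//; under eq_Rintegral do rewrite big_geq// mul0r.
  by rewrite Rintegral_cst// mul0r mulr0.
rewrite big_nat_recr//= IH; under [in RHS]eq_Rintegral do rewrite big_nat_recr//= mulrDl.
rewrite RintegralD//; last 2 first.
- apply: bounded_measurable_mul_integrable => //.
  exact: (@bounded_measurable_sum _ (fun k t => _)).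
- exact: bounded_measurable_mul_integrable.
rewrite mulrDr; congr (_ + _).
have E t : w m * cos (m%:R * (x - t) - b) * phi t =
   (w m * cos (m%:R * x)) * (cos (m%:R * t + b) * phi t) +
   (w m * sin (m%:R * x)) * (cos (m%:R * t + (b - pi / 2)) * phi t).
  have -> : m%:R * (x - t) - b = m%:R * x - (m%:R * t + b) by ring.
  by rewrite cosB addrA cosBpihalf; ring.
under eq_Rintegral do rewrite E.
have i c := bounded_measurable_mul_integrable (bmc m%:R c) iphi.
have i2 z c : mu.-integrable `[- pi, pi]
    (EFin \o (fun t => z * (cos (m%:R * t + c) * phi t))).
  rewrite (_ : (fun t => _) = (fun t => z * cos (m%:R * t + c) * phi t)); last first.
    by apply/funext => t; rewrite mulrA.
  apply: bounded_measurable_mul_integrable => //.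
  by apply: bounded_measurableM => //; exact: bounded_measurable_cst.
rewrite RintegralD// !RintegralZl// /U /V; ring.
Qed.

(** Convolving term by term makes f a uniform limit of trigonometric polynomials with coefficients U
    and V. Its Fourier sum is therefore one of them, and the difference is the convolution with the
    tail of the kernel. *)
Lemma fourier_remainder m x :
  f x - fourier_sum m f x = pi^-1 * \int[mu]_(t in `[- pi, pi])
   ((cos_series b (x - t) - \sum_(1 <= k < m.+1) w k * cos (k%:R * (x - t) - b)) * phi t).
Proof.
have bmc := bounded_measurable_cos_series b.
have bmS y : bounded_measurable (fun t => cos_series b (y - t)).
  have := bounded_measurable_affine (-1) y bmc; congr bounded_measurable.
  by apply/funext => t; congr cos_series; ring.
have bmp k y : bounded_measurable
    (fun t : R => \sum_(1 <= j < k) w j * cos (j%:R * (y - t) - b)).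
  apply: (@bounded_measurable_sum _ (fun k t => _)) => j.
  apply: bounded_measurableM; first exact: bounded_measurable_cst.
  have := @bounded_measurable_cos R (- j%:R) (j%:R * y - b); congr bounded_measurable.
  by apply/funext => t; congr cos; ring.
have diff k y : f y - trig_poly (a / 2) U V k y = pi^-1 * \int[mu]_(t in `[- pi, pi])
   ((cos_series b (y - t) - \sum_(1 <= j < k) w j * cos (j%:R * (y - t) - b)) * phi t).
  under [in RHS]eq_Rintegral do rewrite mulrBl.
  rewrite RintegralB//; last 2 first.
  - exact: bounded_measurable_mul_integrable.
  - exact: bounded_measurable_mul_integrable.
  by rewrite partial_integral /f; ring.
pose B := \int[mu]_(t in `[- pi, pi]) `|phi t|.
pose eta k := pi^-1 * (series_tail k * B).
have feta k y : `|f y - trig_poly (a / 2) U V k y| <= eta k.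
  rewrite diff normrM ger0_norm ?invr_ge0 ?pi_ge0// ler_wpM2l ?invr_ge0 ?pi_ge0//.
  apply: (@Rintegral_norm_le R (fun t => cos_series b (y - t) - _)) => //.
    exact: bounded_measurableB.
  by move=> t; exact: cos_series_approx.
have eta0 : eta k @[k --> \oo] --> (0 : R).
  rewrite -(mulr0 pi^-1) -(mul0r B); apply: cvgMr; apply: cvgMl.
  exact: series_tail_cvg0.
(* Measurability in x is inherited from the approximating polynomials, so no joint measurability is
   involved. *)
have bf : bounded_measurable f.
  split.
    refine (@measurable_fun_cvg _ _ R setT (trig_poly (a / 2) U V) _ _ _).
      by move=> k; exact: (bounded_measurable_trig_poly _ _ _ _).1.
    move=> y _; apply/cvgrPdist_lt => e e0.
    move/cvgrPdist_lt: eta0 => /(_ _ e0) [N _ HN]; exists N => // k /HN.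
    rewrite /= sub0r normrN; apply: le_lt_trans.
    by rewrite (le_trans (feta k y))// ler_norm.
  have [_ [M hM]] := bounded_measurable_trig_poly (a / 2) U V 0.
  exists (eta 0%N + M) => y.
  rewrite -[f y](subrK (trig_poly (a / 2) U V 0 y)).
  by rewrite (le_trans (ler_normD _ _))// lerD.
by rewrite (fourier_sum_uniform_limit m x bf feta eta0) diff.
Qed.

End convolution.
End cosine_series.

(** * Pointwise approximation of the tail *)

Section pointwise.
Context {R : realType}.

Definition expcoef (al r : R) k : R := expR (- al * k%:R `^ r).

Definition scaled_tail (al r : R) n (b t : R) : R :=
  expR (al * n%:R `^ r) * (cos_series (expcoef al r) b t -
    \sum_(1 <= k < n) expcoef al r k * cos (k%:R * t - b)).

Definition cell_start n (t : R) : R :=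
  2 * pi / n%:R * (Num.floor (n%:R * t / (2 * pi)))%:~R.

(* Leading term of [scaled_tail], with amplitude and phase frozen at the left
   end of the cell of length [2 * pi / n] containing [t]. *)
Definition cell_wave q n (b t : R) : R :=
  amp q (cell_start n t) * cos (n%:R * t - b + phase q (cell_start n t)).

Variables (al r : R) (n : nat).
Hypotheses (al0 : 0 < al) (r01 : 0 < r < 1) (n0 : (0 < n)%N).
Local Notation w := (expcoef al r).
Local Notation a := (decay al r n).
Local Notation d := (dlt al r n).
Local Notation N := (Neps al r n).
Hypotheses (N14 : 14 <= N) (d14 : d <= 1 / 14).
Local Notation q := (expR (- d)).

Let nR0 : 0 < n%:R :> R. Proof. by rewrite ltr0n. Qed.
Let N1 : 1 < N. Proof. by move: N14; lra. Qed.

Lemma Neps_dlt : N = d * n%:R.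
Proof. by rewrite /Neps /dlt -[RHS]mulrA divfK// gt_eqF. Qed.

Lemma dlt_gt0 : 0 < d.
Proof.
by rewrite /dlt !mulr_gt0 ?invr_gt0 ?powR_gt0//; case/andP: r01.
Qed.

Lemma ratio01 : 0 < q < 1.
Proof. by rewrite expR_gt0/= expR_lt1 oppr_lt0 dlt_gt0. Qed.

(** [A <= 1 / (1 - q)] and [d <= (1 + d) (1 - q)], with [1 + d <= 15/14]. *)
Lemma amp_dlt_le t : d * amp q t <= 15 / 14.
Proof.
have [_ q1 h] := expRN_bounds dlt_gt0; have d0 := dlt_gt0.
have q10 : 0 < 1 - q by rewrite subr_gt0.
have := ler_wpM2l (ltW d0) (amp_le ratio01 t); move=> /le_trans; apply.
by rewrite ler_pdivrMr//; apply: le_trans h _; rewrite ler_pM2r//; move: d14; lra.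
Qed.

Lemma amp_div_n_le t : amp q t / n%:R <= 15 / 14 / N.
Proof.
rewrite ler_pdivrMr// mulrAC ler_pdivlMr ?(lt_trans _ N1)//.
by rewrite Neps_dlt mulrA ler_pM2r// mulrC amp_dlt_le.
Qed.

Lemma expcoefD j : w (n + j) = expR (- (al * n%:R `^ r)) * a j.
Proof. by rewrite /expcoef /decay -expRD; congr expR; ring. Qed.

Lemma expcoef_ge0 k : 0 <= w k. Proof. exact: expR_ge0. Qed.

Lemma cvg_series_expcoef : cvgn (series w).
Proof.
apply: nondecreasing_is_cvgn.
  by apply: nondecreasing_series => k _ _; exact: expcoef_ge0.
exists (series w n + expR (- (al * n%:R `^ r)) * (1 + (n%:R + 1) / (N - 1))).
move=> _ [m _ <-].
have nd : nondecreasing_seq (series w).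
  by apply: nondecreasing_series => k _ _; exact: expcoef_ge0.
apply: le_trans (nd _ _ (leq_addl n m)) _.
rewrite /series/= (@big_cat_nat _ _ _ n)//= ?leq_addr// lerD2l.
rewrite -{1}[n]add0n big_addn addKn.
under eq_bigr do rewrite addnC expcoefD.
rewrite -mulr_sumr ler_wpM2l ?expR_ge0// big_mkord.
case: m => [|m].
  by rewrite big_ord0 addr_ge0// divr_ge0// subr_ge0 ltW.
by rewrite big_ord_recl decay0 lerD2l; exact: decay_sum_le.
Qed.

(** The geometric approximation costs [4 (d + 15/13 / N) A] in the limit. Since [d A <= 15/14], its
    first part is bounded and only the second is relative to A. *)
Lemma scaled_tail_wave b t :
  `|scaled_tail al r n b t - amp q t * cos (n%:R * t - b + phase q t)| <=
  5 + 5 * (amp q t / N).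
Proof.
have d0 := dlt_gt0; have A0 := amp_gt0 ratio01 t.
have N0 : 0 < N by exact: lt_trans N1.
set G := amp q t * _.
have step m : `|\sum_(j < m) a j * cos (j%:R * t + (n%:R * t - b)) - G| <=
    4 * (d + 15 / 13 / N) * amp q t + 8 * amp q t * a m.
  have ratio j : q * a j <= a j.+1 by exact: decay_ratio_ge.
  have := @geometric_approx _ _ ratio01 a m (n%:R * t - b) t (decay0 _ _ _)
    (fun j => decay_ge0 _ _ _ j) ratio.
  move=> /le_trans; apply.
  have q1 : 0 <= 1 - q by rewrite subr_ge0 ltW//; case/andP: ratio01.
  have qd : 1 - q <= d by have [h _ _] := expRN_bounds d0; lra.
  have S : \sum_(j < m) a j <= 1 + (n%:R + 1) / (N - 1).
    case: m => [|m].
      by rewrite big_ord0 addr_ge0// divr_ge0// subr_ge0 ltW.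
    by rewrite big_ord_recl decay0 lerD2l; exact: decay_sum_le.
  have S0 : 0 <= \sum_(j < m) a j by apply: sumr_ge0 => j _; exact: decay_ge0.
  have h1 : (1 - q) * \sum_(j < m) a j - 1 <= d + 15 / 13 / N.
    have := ler_pM q1 S0 qd S.
    have -> : d * (1 + (n%:R + 1) / (N - 1)) = d + 1 + (1 + d) / (N - 1).
      by rewrite mulrDr mulr1 mulrA mulrDr -Neps_dlt mulr1; field; rewrite subr_eq0 gt_eqF.
    (* 15/13 is 15/14, a bound of [1 + d], over 13/14, a lower bound of [(N - 1) / N]. *)
    suff : (1 + d) / (N - 1) <= 15 / 13 / N by lra.
    rewrite ler_pdivrMr ?subr_gt0// mulrAC ler_pdivlMr//.
    by have := ler_wpM2r (ltW N0) d14; move: N14; lra.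
  have := ler_wpM2r (ltW A0) h1; lra.
have cv : (fun m => `|\sum_(j < m) a j * cos (j%:R * t + (n%:R * t - b)) - G|) @ \oo
    --> `|scaled_tail al r n b t - G|.
  apply: cvg_norm; apply: cvgB; last exact: cvg_cst.
  have E m : \sum_(j < m) a j * cos (j%:R * t + (n%:R * t - b)) =
      expR (al * n%:R `^ r) * ((\sum_(1 <= k < m + n) w k * cos (k%:R * t - b)) -
        \sum_(1 <= k < n) w k * cos (k%:R * t - b)).
    rewrite (@big_cat_nat _ _ _ n)//= ?leq_addl// addrAC subrr add0r.
    rewrite (big_addn 0 (m + n) n xpredT) addnK big_mkord mulr_sumr.
    apply: eq_bigr => j _; rewrite addnC expcoefD mulrA mulrA -expRD subrr expR0 mul1r.
    by congr (_ * cos _); rewrite natrD; ring.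
  under eq_fun do rewrite E.
  apply: cvgMr; apply: cvgB; last exact: cvg_cst.
  have := @cos_series_cvg R w expcoef_ge0 cvg_series_expcoef b t.
  by rewrite -(cvg_shiftn n).
have bd : (fun m => 4 * (d + 15 / 13 / N) * amp q t + 8 * amp q t * a m) @ \oo
    --> 4 * (d + 15 / 13 / N) * amp q t.
  rewrite -[X in _ --> X]addr0 -(mulr0 (8 * amp q t)).
  by apply: cvgD; [exact: cvg_cst|apply: cvgMr; exact: decay_cvg0].
apply: (@le_trans _ _ (4 * (d + 15 / 13 / N) * amp q t)).
  by apply: (ler_cvg_to cv bd); exact: nearW.
have := amp_dlt_le t; have : 0 <= amp q t / N by rewrite divr_ge0 ?ltW.
move: (amp q t) => A; have -> : 4 * (d + 15 / 13 / N) * A = 4 * (d * A) + 60 / 13 * (A / N).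
  by field; lra.
lra.
Qed.

Lemma cell_startP t : 0 <= t - cell_start n t < 2 * pi / n%:R.
Proof.
have p0 : 0 < 2 * pi :> R by rewrite mulr_gt0// pi_gt0.
have h0 : 0 < 2 * pi / n%:R :> R by rewrite divr_gt0.
rewrite /cell_start; set h := 2 * pi / n%:R in h0 *.
have -> : n%:R * t / (2 * pi) = t / h by rewrite /h invf_div mulrCA mulrA.
have /andP[h1 h2] := floor_itv (t / h).
rewrite subr_ge0 ltrBlDr mulrC -ler_pdivlMr// h1/=.
by rewrite -[X in X + _]mul1r -mulrDl -ltr_pdivrMr// addrC; rewrite intrD in h2.
Qed.

Let dist_cell_start t : `|t - cell_start n t| <= 8 / n%:R.
Proof.
have /andP[h1 h2] := cell_startP t; rewrite ger0_norm// (le_trans (ltW h2))//.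
rewrite ler_pM2r ?invr_gt0//; have := @pihalf_lt2 R; lra.
Qed.

(** A cell is shorter than [8 / n], and [A / n <= 15/14 / N] at its left end; [60/7 = 8 * 15/14]. *)
Lemma amp_mul_dist_le t : amp q t * amp q (cell_start n t) * `|t - cell_start n t| <=
  60 / 7 * (amp q t / N).
Proof.
have A0 := amp_gt0 ratio01.
have -> : 60 / 7 * (amp q t / N) = amp q t * (60 / 7 / N) by ring.
rewrite -mulrA ler_pM2l//.
have := ler_wpM2l (ltW (A0 (cell_start n t))) (dist_cell_start t).
have := amp_div_n_le (cell_start n t); lra.
Qed.

Lemma amp_cell_start t : `|amp q t - amp q (cell_start n t)| <= 18 * (amp q t / N).
Proof.
apply: le_trans (amp_lipschitz ratio01 _ _) _.
have := amp_mul_dist_le t.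
have : 0 <= amp q t / N by rewrite divr_ge0 ?ltW ?amp_gt0 ?ratio01// (lt_trans _ N1).
lra.
Qed.

(** 74 rounds up [5 + 8 * 60/7]: the geometric approximation plus the freezing of amplitude and
    phase. *)
Lemma scaled_tail_cell_wave b t :
  `|scaled_tail al r n b t - cell_wave q n b t| <= 5 + 74 * (amp q t / N).
Proof.
rewrite -(subrK (amp q t * cos (n%:R * t - b + phase q t)) (scaled_tail al r n b t)).
rewrite -addrA; apply: le_trans (ler_normD _ _) _.
have h1 := scaled_tail_wave b t.
have h2 := amp_cos_lipschitz ratio01 (n%:R * t - b) t (cell_start n t).
have h3 := amp_mul_dist_le t.
have : 0 <= amp q t / N by rewrite divr_ge0 ?ltW ?amp_gt0 ?ratio01// (lt_trans _ N1).
rewrite /cell_wave; lra.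
Qed.

End pointwise.

(** * Norms over a period *)

(** The default value of [fine] does not intervene for bounded measurable f and [s >= 0], where the
    integral is finite ([pow_integralE]). *)
HB.lock Definition pow_integral {R : realType} (s : R) (f : R -> R) : R :=
  fine (\int[@lebesgue_measure R]_(t in `[0%R, (2 * pi)%R[) (`|f t| `^ s)%:E)%E.

HB.lock Definition pnorm {R : realType} (s : R) (f : R -> R) : R :=
  pow_integral s f `^ s^-1.

Section period_norm.
Context {R : realType}.
Implicit Types (f g h : R -> R) (s p : R).
Local Notation mu := (@lebesgue_measure R).
Local Notation T := (2 * pi : R).
Local Notation meas f :=
  (measurable_fun [set: measurableTypeR R] (f : measurableTypeR R -> measurableTypeR R)).

Lemma period_gt0 : 0 < T. Proof. by rewrite mulr_gt0// pi_gt0. Qed.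

Lemma period_lt8 : T < 8. Proof. by have := @pihalf_lt2 R; lra. Qed.

Lemma integral_period_cst (c : R) :
  (\int[mu]_(t in `[0%R, T[) c%:E = (c * T)%:E)%E.
Proof.
rewrite (integral_cst mu (measurable_itv _) c%:E) /= lebesgue_measure_itv/=.
by rewrite lte_fin period_gt0/= sube0 EFinM.
Qed.

Lemma integral_period_measure (F : R -> \bar R) :
  measurable_fun [set: R] F -> (forall x, 0%R <= F x)%E ->
  (\int[period_measure R]_x F x = \int[mu]_(x in `[0%R, T[) F x)%E.
Proof. by move=> mF F0; rewrite -(@ge0_integral_mrestr _ _ (measurable_itv `[0, T[)). Qed.

Lemma measurable_norm_powR f s : measurable_fun [set: R] f ->
  measurable_fun [set: R] (fun t => (`|f t| `^ s)%:E).
Proof.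
move=> mf; apply/measurable_EFinP.
apply: (@measurableT_comp _ _ _ _ _ _ (@powR R ^~ s)) => //.
exact: measurableT_comp.
Qed.

Lemma normLE f s : measurable_fun [set: R] f ->
  (normL s%:E f = (\int[mu]_(t in `[0%R, T[) (`|f t| `^ s)%:E) `^ s^-1)%E.
Proof.
move=> mf; rewrite /normL unlock -integral_period_measure.
- by under eq_integral do rewrite /= -poweR_EFin.
- exact: measurable_norm_powR.
- by move=> x; rewrite lee_fin powR_ge0.
Qed.

Lemma normL1E f : measurable_fun [set: R] f ->
  (normL 1%:E f = \int[mu]_(t in `[0%R, T[) `|f t|%:E)%E.
Proof.
move=> mf; rewrite normLE// invr1 poweRe1.
  by apply: eq_integral => t _; rewrite powRr1.
by apply: integral_ge0 => t _; rewrite lee_fin powR_ge0.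
Qed.

Lemma pow_integralE s f : bounded_measurable f -> 0 <= s ->
  (\int[mu]_(t in `[0%R, T[) (`|f t| `^ s)%:E = (pow_integral s f)%:E)%E.
Proof.
move=> [mf [B hB]] s0; rewrite pow_integral.unlock fineK// ge0_fin_numE; last first.
  by apply: integral_ge0 => t _; rewrite lee_fin powR_ge0.
apply: (@le_lt_trans _ _ (\int[mu]_(t in `[0%R, T[) cst (B `^ s)%:E t)%E).
  apply: ge0_le_integral => //.
  - by apply: measurable_funTS; exact: measurable_norm_powR.
  - move=> t _; rewrite lee_fin ge0_ler_powR// ?nnegrE//.
    by rewrite (le_trans _ (hB 0)).
by rewrite integral_period_cst ltry.
Qed.

Lemma pow_integral_ge0 s f : 0 <= pow_integral s f.
Proof.
rewrite pow_integral.unlock; apply: fine_ge0; apply: integral_ge0 => t _.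
by rewrite lee_fin powR_ge0.
Qed.

Lemma pnorm_ge0 s f : 0 <= pnorm s f. Proof. by rewrite pnorm.unlock powR_ge0. Qed.

Lemma pnormE s f : bounded_measurable f -> 0 <= s -> normL s%:E f = (pnorm s f)%:E.
Proof.
by move=> bf s0; rewrite (normLE _ bf.1) (pow_integralE bf s0) poweR_EFin pnorm.unlock.
Qed.

Lemma pow_integralZ s f c : 0 <= c -> 0 <= s -> bounded_measurable f ->
  pow_integral s (fun t => c * f t) = c `^ s * pow_integral s f.
Proof.
move=> c0 s0 bf; have bcf : bounded_measurable (fun t => c * f t).
  by apply: bounded_measurableM => //; exact: bounded_measurable_cst.
apply: EFin_inj; rewrite EFinM -(pow_integralE bcf s0) -(pow_integralE bf s0).
under eq_integral do rewrite normrM (ger0_norm c0) powRM// EFinM.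
rewrite ge0_integralZl//.
- by apply: measurable_funTS; apply: measurable_norm_powR; exact: bf.1.
- by rewrite lee_fin powR_ge0.
Qed.

Lemma pnormZ s f c : 0 <= c -> 0 < s -> bounded_measurable f ->
  pnorm s (fun t => c * f t) = c * pnorm s f.
Proof.
move=> c0 s0 bf; rewrite pnorm.unlock (pow_integralZ c0 (ltW s0) bf).
rewrite (powRM _ (powR_ge0 _ _) (pow_integral_ge0 _ _)).
by rewrite -powRrM mulfV ?gt_eqF// powRr1.
Qed.

Lemma pow_integral_cst s c : 0 <= c -> pow_integral s (fun=> c) = c `^ s * T.
Proof.
move=> c0; rewrite pow_integral.unlock (ger0_norm c0).
by rewrite integral_period_cst.
Qed.

(** Uniform in s, since [2 pi >= 1] gives [(2 pi)^(1/s) <= 2 pi < 8]. *)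
Lemma pnorm_cst_le s c : 0 <= c -> 1 <= s -> pnorm s (fun=> c) <= 8 * c.
Proof.
move=> c0 s1; have s0 : 0 < s by exact: lt_le_trans s1.
rewrite pnorm.unlock (pow_integral_cst s c0) (powRM _ (powR_ge0 _ _) (ltW period_gt0)).
rewrite -powRrM mulfV ?gt_eqF// powRr1// mulrC ler_wpM2r//.
apply: le_trans (ltW period_lt8); apply: ler1_powR; last by rewrite invf_le1.
by have := @pihalf_ge1 R; lra.
Qed.

Lemma le_pnorm s f g : 0 < s -> bounded_measurable f -> bounded_measurable g ->
  (forall t, 0 <= t < T -> `|f t| <= `|g t|) -> pnorm s f <= pnorm s g.
Proof.
move=> s0 bf bg fg; have s0' := ltW s0.
rewrite pnorm.unlock; apply: ge0_ler_powR; rewrite ?invr_ge0 ?nnegrE ?pow_integral_ge0//.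
rewrite -lee_fin -(pow_integralE bf s0') -(pow_integralE bg s0').
apply: ge0_le_integral => //.
- by apply: measurable_funTS; apply: measurable_norm_powR; exact: bf.1.
- by apply: measurable_funTS; apply: measurable_norm_powR; exact: bg.1.
- move=> t /=; rewrite in_itv/= => tT.
  by rewrite lee_fin ge0_ler_powR ?nnegrE// fg.
Qed.

Lemma ler_pnormD s f g : 1 <= s -> bounded_measurable f -> bounded_measurable g ->
  pnorm s (fun t => f t + g t) <= pnorm s f + pnorm s g.
Proof.
move=> s1 bf bg; have s0 : 0 <= s by rewrite (le_trans _ s1).
have bfg := bounded_measurableD bf bg.
rewrite -lee_fin EFinD -(pnormE bfg s0) -(pnormE bf s0) -(pnormE bg s0).
by apply: (@eminkowski _ _ _ (period_measure R) f g s%:E); [exact: bf.1|exact: bg.1|].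
Qed.

(** Minkowski's inequality in the form that turns a pointwise error into an error between norms. *)
Lemma pnorm_dist s f g h : 1 <= s -> bounded_measurable f -> bounded_measurable g ->
  bounded_measurable h -> (forall t, 0 <= t < T -> `|f t - g t| <= h t) ->
  `|pnorm s f - pnorm s g| <= pnorm s h.
Proof.
move=> s1 bf bg bh fgh; have s0 : 0 < s by exact: lt_le_trans s1.
have H f' g' : bounded_measurable f' -> bounded_measurable g' ->
    (forall t, 0 <= t < T -> `|f' t - g' t| <= h t) ->
    pnorm s f' <= pnorm s g' + pnorm s h.
  move=> bf' bg' f'g'; have bd := bounded_measurableB bf' bg'.
  have := ler_pnormD s1 bg' bd.
  rewrite (_ : (fun t => g' t + _) = f'); last by apply/funext => t; rewrite subrKC.
  move=> /le_trans; apply; rewrite lerD2l; apply: le_pnorm => // t tT.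
  by apply: le_trans (f'g' t tT) (ler_norm _).
have h1 := H _ _ bf bg fgh.
have h2 : pnorm s g <= pnorm s f + pnorm s h.
  by apply: (H _ _ bg bf) => t tT; rewrite distrC fgh.
rewrite ler_norml lerBlDl h1 andbT lerBrDl; move: h2.
by move: (pnorm s f) (pnorm s g) (pnorm s h) => x y z; lra.
Qed.

(** Links the two windows of the definitions: means and convolutions over [[-pi, pi]], norms over
    [[0, 2 pi[]. *)
Lemma ge0_integral_sym_period (F : R -> \bar R) :
  measurable_fun [set: R] F -> (forall x, 0%R <= F x)%E ->
  (forall x, F (x + T) = F x) ->
  (\int[mu]_(t in `[(- pi)%R, pi%R]) F t = \int[mu]_(t in `[0%R, T[) F t)%E.
Proof.
move=> mF F0 pF; rewrite -integral_itv_bndo_bndc; last exact: measurable_funTS.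
have := @ge0_integral_periodic R T period_gt0 F (- pi) mF F0 pF.
by rewrite (_ : - pi + T = pi)//; ring.
Qed.

Lemma Rintegral_period_le f L : measurable_fun [set: R] f -> periodic f T ->
  (\int[mu]_(t in `[0%R, T[) `|f t|%:E <= L%:E)%E ->
  mu.-integrable `[- pi, pi] (EFin \o f) /\
  `|\int[mu]_(t in `[- pi, pi]) f t| <= L.
Proof.
move=> mf pf fL.
have mnf : measurable_fun [set: R] (fun t => `|f t|%:E).
  by apply/measurable_EFinP; exact: measurableT_comp.
have E : (\int[mu]_(t in `[(- pi)%R, pi%R]) `|f t|%:E = \int[mu]_(t in `[0%R, T[) `|f t|%:E)%E.
  by apply: ge0_integral_sym_period => // x; rewrite pf.
have i : mu.-integrable `[- pi, pi] (EFin \o f).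
  apply/integrableP; split; first by apply/measurable_EFinP; exact: measurable_funTS.
  by rewrite [X in (X < _)%E]E (le_lt_trans fL)// ltry.
split => //; apply: le_trans (le_normr_Rintegral _ i) _ => //.
rewrite /Rintegral E -lee_fin fineK// ge0_fin_numE; last exact: integral_ge0.
by rewrite (le_lt_trans fL)// ltry.
Qed.

Lemma holder_period f phi (p : \bar R) s : (1 <= p)%E -> 1 <= s -> (p^-1 + s%:E^-1 = 1)%E ->
  bounded_measurable f -> measurable_fun [set: R] phi -> (normL p phi <= 1)%E ->
  (\int[mu]_(t in `[0%R, T[) `|f t * phi t|%:E <= (pnorm s f)%:E)%E.
Proof.
move=> p1 s1 ps bf mphi phi1; have s0 : 0 < s by exact: lt_le_trans s1.
have mfp : measurable_fun [set: R] (fun t => f t * phi t).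
  by apply: measurable_funM => //; exact: bf.1.
rewrite -(normL1E mfp) -(pnormE bf (ltW s0)).
move: ps; rewrite inver (gt_eqF s0); case: p p1 phi1 => [q| |]// q1 phi1.
  rewrite lee_fin in q1; have q0 : 0 < q by exact: lt_le_trans q1.
  rewrite inver (gt_eqF q0) -EFinD => -[qs].
  have := @hoelder _ _ _ (period_measure R) f phi s q bf.1 mphi s0 q0.
  rewrite addrC => /(_ qs) h; apply: le_trans h _.
  rewrite -[leRHS]mule1; apply: lee_pmul => //; exact: Lnorm_ge0.
rewrite invey add0e => -[s1']; have {s1'} -> : s = 1 by rewrite -[s]invrK s1' invr1.
rewrite /normL Lnorm.unlock /= in phi1; rewrite /normL !Lnorm1; move: phi1.
case: ifPn => [_ /ess_supP phi1|P0 _].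
  apply: ae_ge0_le_integral => //.
  - by do 2 apply: measurableT_comp => //.
  - by do 2 apply: measurableT_comp => //; exact: bf.1.
  - apply: filterS phi1 => x /= h _; rewrite lee_fin normrM ler_piMr//.
(* This branch of the norm at infinity concerns a space of measure zero, whereas the period has
   positive measure. *)
exfalso; move: P0; rewrite -leNgt /= /period_measure/= /mrestr setTI.
by rewrite lebesgue_measure_itv/= lte_fin period_gt0/= sube0 lee_fin leNgt period_gt0.
Qed.

Lemma bounded_mul_L1_le f phi C : measurable_fun [set: R] f ->
  (forall t, `|f t| <= C) -> measurable_fun [set: R] phi -> (normL 1 phi <= 1)%E ->
  (\int[mu]_(t in `[0%R, T[) `|f t * phi t|%:E <= C%:E)%E.
Proof.
move=> mf fC mphi; rewrite normL1E// => phi1.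
have C0 : 0 <= C by rewrite (le_trans _ (fC 0)).
have mn g : measurable_fun [set: R] g -> measurable_fun [set: R] (fun t => `|g t|%:E).
  by move=> mg; apply/measurable_EFinP; exact: measurableT_comp.
apply: (@le_trans _ _ (C%:E * \int[mu]_(t in `[0%R, T[) `|phi t|%:E)%E); last first.
  by rewrite -[leRHS]mule1; apply: lee_wpmul2l.
rewrite -ge0_integralZl//; last by apply: measurable_funTS; exact: mn.
apply: ge0_le_integral => //.
- by apply: measurable_funTS; apply: mn; exact: measurable_funM.
- apply: measurable_funTS; apply/measurable_EFinP; apply: measurable_funM => //.
  exact: measurableT_comp.
- by move=> t _; rewrite -EFinM lee_fin normrM ler_wpM2r.
Qed.

End period_norm.

(** * Distribution of the cell wave *)

Section cell_wave.
Context {R : realType}.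
Local Notation mu := (@lebesgue_measure R).
Local Notation T := (2 * pi : R).

Let T0 : 0 < T. Proof. exact: period_gt0. Qed.

Lemma cosDT (x : R) : cos (x + T) = cos x.
Proof. by rewrite mulr_natl cosD2pi. Qed.

Lemma sinDT (x : R) : sin (x + T) = sin x.
Proof. by rewrite mulr_natl sinD2pi. Qed.

Lemma amp_periodic (q x : R) : amp q (x + T) = amp q x.
Proof. by rewrite /amp /den_norm2 /den_re /den_im cosDT sinDT. Qed.

Lemma phase_periodic (q x : R) : phase q (x + T) = phase q x.
Proof. by rewrite /phase /den_re /den_im cosDT sinDT. Qed.

Lemma cos_natr_shift n (x : R) : cos (x + n%:R * T) = cos x.
Proof. by rewrite -{1}[n%:R]/(n%:Z%:~R) (@periodic_int _ T _ cos) //; exact: cosDT. Qed.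

Variables (q b : R) (n : nat).
Hypotheses (q01 : 0 < q < 1) (n0 : (0 < n)%N).
Let nR0 : 0 < n%:R :> R. Proof. by rewrite ltr0n. Qed.

Lemma cell_startD t : cell_start n (t + T) = cell_start n t + T.
Proof.
rewrite /cell_start; have -> : n%:R * (t + T) / T = n%:R * t / T + n%:R.
  by rewrite mulrDr mulrDl mulfK// gt_eqF.
rewrite -[X in Num.floor (_ + X)]/(n%:Z%:~R) floorDrz ?rpred_int// intrKfloor intrD.
by rewrite mulrDr; congr (_ + _); rewrite divfK// gt_eqF.
Qed.

Lemma cell_start_cell k t : k%:R * (T / n%:R) <= t < k.+1%:R * (T / n%:R) ->
  cell_start n t = k%:R * (T / n%:R).
Proof.
move=> /andP[h1 h2]; have w0 : 0 < T / n%:R by rewrite divr_gt0.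
rewrite /cell_start (_ : Num.floor _ = k%:Z); first by rewrite mulrC.
apply: floor_def; have -> : n%:R * t / T = t / (T / n%:R).
  by rewrite invf_div mulrCA mulrA.
rewrite intrD -[k%:Z%:~R]/(k%:R) [1%:~R]/(1%:R) natr1.
by rewrite ler_pdivlMr// ltr_pdivrMr// h1.
Qed.

Lemma cell_wave_periodic : periodic (cell_wave q n b) T.
Proof.
move=> t; rewrite /cell_wave cell_startD amp_periodic phase_periodic; congr (_ * _).
by rewrite -(cos_natr_shift n (n%:R * t - b + _)); congr cos; ring.
Qed.

Lemma measurable_cell_start : measurable_fun [set: R] (cell_start n : R -> R).
Proof.
apply: measurable_funM => //.
apply: (@measurableT_comp _ _ _ _ _ _ (fun x : R => (Num.floor x)%:~R : R)).
  apply: nondecreasing_measurable => // x y xy.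
  by rewrite ler_int; exact: le_floor.
have := @measurable_affine R (n%:R / T) 0; congr measurable_fun.
by apply/funext => t; rewrite addr0 mulrAC.
Qed.

Lemma continuous_amp : continuous (amp q).
Proof.
move=> t; apply: cvgV; first by rewrite gt_eqF// sqrtr_gt0 den_norm2_gt0.
apply: continuous_comp; last exact: sqrt_continuous.
apply: cvgD; rewrite expr2 /den_re /den_im.
  by apply: cvgM; (apply: cvgB; [exact: cvg_cst|
    apply: cvgM; [exact: cvg_cst|exact: continuous_cos]]).
by apply: cvgM; (apply: cvgM; [exact: cvg_cst|exact: continuous_sin]).
Qed.

Lemma continuous_phase : continuous (phase q).
Proof.
move=> t; apply: continuous_comp; last exact: continuous_atan.
apply: cvgM; first by apply: cvgM; [exact: cvg_cst|exact: continuous_sin].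
apply: cvgV; first by rewrite gt_eqF// den_re_gt0.
by apply: cvgB; [exact: cvg_cst|apply: cvgM; [exact: cvg_cst|exact: continuous_cos]].
Qed.

Lemma bounded_measurable_amp : bounded_measurable (amp q).
Proof.
split; first by apply: continuous_measurable_fun; exact: continuous_amp.
by exists (1 - q)^-1 => t; rewrite ger0_norm ?amp_le// ltW// amp_gt0.
Qed.

Lemma bounded_measurable_amp_cell : bounded_measurable (fun t => amp q (cell_start n t)).
Proof.
have [ma [B hB]] := bounded_measurable_amp; split; last by exists B.
exact: measurableT_comp measurable_cell_start.
Qed.

Lemma bounded_measurable_cell_wave : bounded_measurable (cell_wave q n b).
Proof.
apply: bounded_measurableM; first exact: bounded_measurable_amp_cell.
split; last by exists 1 => t; exact: cos_max.
apply: (@measurableT_comp _ _ _ _ _ _ (@cos R)).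
  by apply: continuous_measurable_fun; exact: continuous_cos.
apply: measurable_funD; first exact: measurable_affine.
apply: (@measurableT_comp _ _ _ _ _ _ (phase q)).
  by apply: continuous_measurable_fun; exact: continuous_phase.
exact: measurable_cell_start.
Qed.

Local Notation A k := (amp q (k%:R * (T / n%:R))).

(** On cell k the wave is [A k * cos (n t + c k)] with [c k] constant; a shift over a full period
    removes [c k], so the distribution of the wave forgets the phases. *)
Lemma integral_cell_wave (g : R -> \bar R) :
  measurable_fun [set: R] g -> (forall x, 0%R <= g x)%E ->
  (\int[mu]_(t in `[0%R, T[) g (cell_wave q n b t) =
   \sum_(k < n) (n%:R^-1)%:E * \int[mu]_(u in `[0%R, T[) g (A k * cos u)%R)%E.
Proof.
move=> mg g0.
pose c k := phase q (k%:R * (T / n%:R)) - b.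
have mgc k : measurable_fun [set: R] (fun u : R => g (A k * cos u)).
  apply: measurableT_comp => //; apply: measurable_funM => //.
  by apply: continuous_measurable_fun; exact: continuous_cos.
rewrite (@ge0_integral_cells R T T0 n _ (fun k u => g (A k * cos (u + c k))))//.
- apply: eq_bigr => k _; congr (_ * _)%E.
  apply: (@ge0_integral_periodic_shift R T T0 (fun u => g (A k * cos u))) => //.
  by move=> u; rewrite cosDT.
- by apply: measurableT_comp => //; exact: bounded_measurable_cell_wave.1.
- move=> k; apply: (@measurableT_comp _ _ _ _ _ _ (fun u => g (A k * cos u))) => //.
  by have := @measurable_affine R 1 (c k); under eq_fun do rewrite mul1r.
- by move=> k x; rewrite addrAC cosDT.
- move=> k t kn ht; rewrite /cell_wave (cell_start_cell ht); congr (g (_ * cos _)).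
  by rewrite /c; ring.
Qed.

Lemma integral_amp_cell (g : R -> R) :
  measurable_fun [set: R] g -> (forall x, 0 <= g x) ->
  (\int[mu]_(t in `[0%R, T[) (g (amp q (cell_start n t)))%:E =
   (\sum_(k < n) n%:R^-1 * (g (A k) * T))%:E)%E.
Proof.
move=> mg g0.
rewrite (@ge0_integral_cells R T T0 n _ (fun k _ => (g (A k))%:E))//.
- by rewrite -sumEFin; apply: eq_bigr => k _; rewrite integral_period_cst EFinM.
- apply/measurable_EFinP; apply: measurableT_comp => //.
  exact: bounded_measurable_amp_cell.1.
- by move=> x; rewrite lee_fin.
- by move=> k _; rewrite lee_fin.
- by move=> k t kn ht; rewrite (cell_start_cell ht).
Qed.

(** The power splits as [A k ^ s] times that of the cosine, whose integral is the same on every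
    cell. *)
Lemma pow_integral_cell_wave s : 0 <= s ->
  pow_integral s (cell_wave q n b) * T =
  pow_integral s cos * pow_integral s (fun t => amp q (cell_start n t)).
Proof.
move=> s0.
have bcos : bounded_measurable (@cos R).
  by have := @bounded_measurable_cos R 1 0; under eq_fun do rewrite mul1r addr0.
have mn : measurable_fun [set: R] (fun x : R => `|x| `^ s).
  apply: (@measurableT_comp _ _ _ _ _ _ (@powR R ^~ s)) => //.
have -> : pow_integral s (cell_wave q n b) =
    \sum_(k < n) n%:R^-1 * (A k `^ s * pow_integral s cos).
  apply: EFin_inj; rewrite -(pow_integralE bounded_measurable_cell_wave s0).
  rewrite (@integral_cell_wave (fun x => (`|x| `^ s)%:E))//; last first.
    exact/measurable_EFinP.
  rewrite -sumEFin; apply: eq_bigr => k _; rewrite EFinM; congr (_ * _)%E.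
  have A0 : 0 <= A k by rewrite ltW// amp_gt0.
  by rewrite -(pow_integralZ A0 s0 bcos) pow_integralE//;
    apply: bounded_measurableM => //; exact: bounded_measurable_cst.
have -> : pow_integral s (fun t => amp q (cell_start n t)) =
    \sum_(k < n) n%:R^-1 * (A k `^ s * T).
  apply: EFin_inj; rewrite -(pow_integralE bounded_measurable_amp_cell s0).
  rewrite (@integral_amp_cell (fun x => `|x| `^ s))//.
  by congr EFin; apply: eq_bigr => k _; rewrite ger0_norm// ltW// amp_gt0.
rewrite mulr_suml mulr_sumr; apply: eq_bigr => k _; ring.
Qed.

Lemma pnorm_cell_wave s : 0 < s ->
  pnorm s (cell_wave q n b) =
  pnorm s cos / T `^ s^-1 * pnorm s (fun t => amp q (cell_start n t)).
Proof.
move=> s0; have := pow_integral_cell_wave (ltW s0); rewrite !pnorm.unlock.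
move=> /(congr1 (@powR R ^~ s^-1)).
rewrite (powRM _ (pow_integral_ge0 _ _) (ltW T0)).
rewrite (powRM _ (pow_integral_ge0 _ _) (pow_integral_ge0 _ _)).
move=> h; rewrite mulrAC -h mulfK// gt_eqF// powR_gt0//.
Qed.

(** A shift by pi changes the sign of [A k * cos u], so the wave and its opposite have the same
    distribution. Positive and negative parts of g are treated separately, which spares an
    integrability assumption. *)
Lemma integral_odd_cell_wave (g : R -> R) : measurable_fun [set: R] g ->
  (forall x, g (- x) = - g x) ->
  \int[mu]_(t in `[- pi, pi]) g (cell_wave q n b t) = 0.
Proof.
move=> mg go.
pose gp x := Num.max (g x) 0.
have mgp : measurable_fun [set: R] (fun x => (gp x)%:E).
  by apply/measurable_EFinP; exact: measurable_maxr.
have mgn : measurable_fun [set: R] (fun x => (gp (- x))%:E).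
  by apply: (@measurableT_comp _ _ _ _ _ _ (fun x => (gp x)%:E)).
have gp0 x : 0 <= gp x by rewrite /gp le_max lexx orbT.
have H (f : R -> \bar R) : measurable_fun [set: R] f -> (forall x, 0%R <= f x)%E ->
    (\int[mu]_(t in `[(- pi)%R, pi%R]) f (cell_wave q n b t) =
     \int[mu]_(t in `[0%R, T[) f (cell_wave q n b t))%E.
  move=> mf f0; apply: (@ge0_integral_sym_period R (fun t => f (cell_wave q n b t))) => //.
    by apply: measurableT_comp => //; exact: bounded_measurable_cell_wave.1.
  by move=> x; rewrite cell_wave_periodic.
suff E : (\int[mu]_(t in `[(- pi)%R, pi%R]) (gp (cell_wave q n b t))%:E =
          \int[mu]_(t in `[(- pi)%R, pi%R]) (gp (- cell_wave q n b t))%:E)%E.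
  rewrite /Rintegral integralE.
  set P := (X in fine (X - _)%E); set Q := (X in fine (_ - X)%E).
  have -> : P = (\int[mu]_(t in `[(- pi)%R, pi%R]) (gp (cell_wave q n b t))%:E)%E.
    by apply: eq_integral => t _; rewrite funepos.unlock/= -EFin_max.
  have -> : Q = (\int[mu]_(t in `[(- pi)%R, pi%R]) (gp (- cell_wave q n b t))%:E)%E.
    by apply: eq_integral => t _; rewrite funeneg.unlock/= -EFin_max /gp go.
  (* If the common value is infinite, [fine] sends the difference to 0 as well. *)
  by rewrite -E; case: (integral _ _ _) => [z| |]//=; rewrite subrr.
have gn0 x : (0%R <= (gp (- x))%:E)%E by rewrite lee_fin.
rewrite (H (fun x => (gp x)%:E))// (H (fun x => (gp (- x))%:E))//.
rewrite (@integral_cell_wave (fun x => (gp x)%:E))//.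
rewrite (@integral_cell_wave (fun x => (gp (- x))%:E))//.
apply: eq_bigr => k _; congr (_ * _)%E.
rewrite -[LHS](@ge0_integral_periodic_shift R T T0 (fun u => (gp (A k * cos u))%:E) pi).
- by apply: eq_integral => t _; rewrite cosDpi mulrN.
- apply: (@measurableT_comp _ _ _ _ _ _ (fun x => (gp x)%:E)) => //.
  apply: measurable_funM => //.
  by apply: continuous_measurable_fun; exact: continuous_cos.
- by move=> x; rewrite lee_fin.
- by move=> u; rewrite cosDT.
Qed.

End cell_wave.

(** * The norm of the amplitude *)

HB.lock Definition rho_integral {R : realType} (d s : R) : R :=
  fine (\int[@lebesgue_measure R]_(t in `[0%R, pi%R[) (rho d t `^ s)%:E)%E.

Section rho_norm.
Context {R : realType}.
Local Notation mu := (@lebesgue_measure R).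
Local Notation T := (2 * pi : R).

Lemma ge0_integral_oppr (f : R -> \bar R) :
  measurable_fun [set: R] f -> (forall x, 0%R <= f x)%E ->
  (\int[mu]_x f (- x)%R = \int[mu]_x f x)%E.
Proof.
move=> mf f0.
have mo : measurable_fun [set: measurableTypeR R]
    (-%R : measurableTypeR R -> measurableTypeR R) by [].
transitivity (\int[pushforward mu (-%R : measurableTypeR R -> measurableTypeR R)]_x f x)%E.
  by rewrite (ge0_integral_pushforward mo)// preimage_setT.
by apply: eq_measure_integral => A mA _; exact: lebesgue_measureN.
Qed.

Lemma ge0_integral_itv_subl (c u v : R) (f : R -> \bar R) :
  measurable_fun [set: R] f -> (forall x, 0%R <= f x)%E ->
  (\int[mu]_(x in `[u, v[) f (c - x)%R =
   \int[mu]_(x in `[(c - v)%R, (c - u)%R[) f x)%E.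
Proof.
move=> mf f0.
(* Reflection exchanges closed and open ends, so the endpoints are discarded first. *)
rewrite integral_itv_bndoo; last first.
  apply: measurable_funTS; apply: measurableT_comp => //.
  by have := @measurable_affine R (-1) c; congr measurable_fun; apply/funext => x; ring.
rewrite [RHS]integral_itv_bndoo; last exact: measurable_funTS.
rewrite integral_mkcond [in RHS]integral_mkcond.
set g := (f \_ _)%E.
have mg : measurable_fun [set: R] g.
  by apply/(measurable_restrictT _ _).1 => //; exact: measurable_funTS.
have g0 x : (0%R <= g x)%E by rewrite /g patchE; case: ifP.
have := @ge0_integral_affine R 1 c g ltr01 mg g0.
rewrite invr1 mul1e => <-.
rewrite -(@ge0_integral_oppr (fun x => g (1 * x + c))); last 2 first.
- apply: measurableT_comp => //; exact: measurable_affine.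
- by move=> x.
apply: eq_integral => x _; rewrite /g mul1r [(- x + c)%R]addrC /patch !mem_setE !in_itv/=.
by rewrite !ltrD2l !ltrN2 andbC.
Qed.

Lemma continuous_rho (d : R) : 0 < d -> continuous (rho d).
Proof.
move=> d0 t; apply: cvgV.
  by rewrite gt_eqF// sqrtr_gt0 ltr_wpDr ?sqr_ge0// exprn_gt0.
apply: continuous_comp; last exact: sqrt_continuous.
by apply: cvgD; [exact: cvg_cst|rewrite expr2; apply: cvgM; exact: cvg_id].
Qed.

Lemma powR_invX2 (x s : R) : 0 < x -> (x ^- 2) `^ (- (s / 2)) = x `^ s.
Proof.
move=> x0; rewrite -powR_mulrn ?(ltW x0)// -powR_inv1 ?powR_ge0// -!powRrM.
by congr powR; field.
Qed.

Lemma fineZ (c : R) (x : \bar R) : 0 < c -> fine (c%:E * x)%E = c * fine x.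
Proof.
by move=> c0; case: x => [x| |] //=; rewrite ?gt0_muley ?gt0_muleNy ?mulr0.
Qed.

Variable d : R.
Hypothesis d0 : 0 < d.

Lemma rho_ge0 t : 0 <= rho d t. Proof. by rewrite invr_ge0 sqrtr_ge0. Qed.

Lemma rho_le t : rho d t <= d^-1.
Proof.
rewrite lef_pV2 ?posrE ?sqrtr_gt0//; last by rewrite ltr_wpDr ?sqr_ge0// exprn_gt0.
by rewrite -[leLHS](gtr0_norm d0) -sqrtr_sqr ler_wsqrtr// lerDl sqr_ge0.
Qed.

Lemma measurable_rho : measurable_fun [set: R] (rho d).
Proof. by apply: continuous_measurable_fun; exact: continuous_rho. Qed.

(** The amplitude is even and [2 pi]-periodic, so on [[0, 2 pi[] it peaks at both ends; folding at
    pi gives [rho] the second peak. *)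
Definition rho_fold t : R := rho d (Num.min t (T - t)).

Lemma bounded_measurable_rho_fold : bounded_measurable rho_fold.
Proof.
split; last by exists d^-1 => t; rewrite ger0_norm ?rho_ge0// rho_le.
apply: (@measurableT_comp _ _ _ _ _ _ (rho d)); first exact: measurable_rho.
apply: measurable_minr => //.
by have := @measurable_affine R (-1) T; congr measurable_fun; apply/funext => t; ring.
Qed.

Lemma rho_foldE t : t <= pi -> rho_fold t = rho d t.
Proof. by move=> tp; rewrite /rho_fold min_l//; lra. Qed.

Lemma rho_foldE_ge t : pi <= t -> rho_fold t = rho d (T - t).
Proof. by move=> tp; rewrite /rho_fold min_r//; lra. Qed.

Lemma amp_even q t : amp q (- t) = amp q t :> R.
Proof. by rewrite /amp /den_norm2 /den_re /den_im cosN sinN mulrN sqrrN. Qed.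

Lemma amp_rho_fold t : d <= 1 / 14 -> 0 <= t < T ->
  `|amp (expR (- d)) t - rho_fold t| <= 10.
Proof.
move=> d14 /andP[t0 tT].
have dd : 0 < d <= 1 / 14 by rewrite d0.
have [tp|tp] := leP t pi.
  by rewrite rho_foldE// amp_rho// ger0_norm.
rewrite rho_foldE_ge ?(ltW tp)// -amp_even -amp_periodic [- t + T]addrC.
by apply: amp_rho => //; rewrite ger0_norm; lra.
Qed.

Lemma measurable_rho_powR s : measurable_fun [set: R] (fun t => (rho d t `^ s)%:E).
Proof.
apply/measurable_EFinP; apply: (@measurableT_comp _ _ _ _ _ _ (@powR R ^~ s)) => //.
exact: measurable_rho.
Qed.

Lemma pow_integral_rho_fold s : 0 <= s ->
  pow_integral s rho_fold = 2 * rho_integral d s.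
Proof.
move=> s0; have p0 := @pi_gt0 R.
have mrf : measurable_fun [set: R] (fun t => (`|rho_fold t| `^ s)%:E).
  by apply: measurable_norm_powR; exact: bounded_measurable_rho_fold.1.
have nrf x : (0%R <= (`|rho_fold x| `^ s)%:E)%E by rewrite lee_fin powR_ge0.
have pT : pi <= T by lra.
have E1 : (\int[mu]_(t in `[0%R, pi%R[) (`|rho_fold t| `^ s)%:E =
    \int[mu]_(t in `[0%R, pi%R[) (rho d t `^ s)%:E)%E.
  apply: eq_integral => t; rewrite inE/= in_itv/= => /andP[_ tp].
  by rewrite rho_foldE ?(ltW tp)// ger0_norm ?rho_ge0.
have Tpi : T - pi = pi by ring.
have E2 : (\int[mu]_(t in `[pi%R, T[) (`|rho_fold t| `^ s)%:E =
    \int[mu]_(t in `[0%R, pi%R[) (rho d t `^ s)%:E)%E.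
  transitivity (\int[mu]_(t in `[pi%R, T[) (rho d (T - t) `^ s)%:E)%E.
    apply: eq_integral => t; rewrite inE/= in_itv/= => /andP[tp _].
    by rewrite rho_foldE_ge// ger0_norm ?rho_ge0.
  rewrite (@ge0_integral_itv_subl T pi T (fun t => (rho d t `^ s)%:E)).
  - by rewrite subrr Tpi.
  - exact: measurable_rho_powR.
  - by move=> x; rewrite lee_fin powR_ge0.
have E := ge0_integral_itvco_split (ltW p0) pT mrf nrf.
rewrite E1 E2 (pow_integralE bounded_measurable_rho_fold s0) in E.
have : (0 <= \int[mu]_(t in `[0%R, pi%R[) (rho d t `^ s)%:E)%E.
  by apply: integral_ge0 => t _; rewrite lee_fin powR_ge0.
move: E; rewrite rho_integral.unlock; case: (integral _ _ _) => [z| |]//=.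
by move=> -[->] _; rewrite mulr_natl mulr2n.
Qed.

Lemma rho_integral_ge0 s : 0 <= rho_integral d s.
Proof.
rewrite rho_integral.unlock; apply: fine_ge0; apply: integral_ge0 => t _.
by rewrite lee_fin powR_ge0.
Qed.

Lemma pnorm_rho_fold s : 1 <= s ->
  pnorm s rho_fold = 2 `^ s^-1 * rho_integral d s `^ s^-1.
Proof.
move=> s1; rewrite pnorm.unlock pow_integral_rho_fold ?powRM ?rho_integral_ge0//.
by rewrite (le_trans _ s1).
Qed.

(** Substituting [t / d] turns [(t^2 + 1)^(-s/2)] into [d^s * rho^s]; the Jacobian and the root then
    leave the power [1 - 1/s] of d. *)
Lemma J_rho s : 1 <= s ->
  J s%:E (pi / d) = d `^ (1 - s^-1) * rho_integral d s `^ s^-1.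
Proof.
move=> s1; have s0 : 0 < s by exact: lt_le_trans s1.
have mf : measurable_fun [set: R] (fun t : R => ((t ^+ 2 + 1) `^ (- (s / 2)))%:E).
  apply/measurable_EFinP.
  apply: (@measurableT_comp _ _ _ _ _ _ (@powR R ^~ (- (s / 2)))) => //.
  by apply: measurable_funD => //; exact: measurable_funX.
rewrite /J /Rintegral -integral_itv_bndo_bndc; last exact: measurable_funTS.
have := @ge0_integral_itv_affine R d^-1 0 0 pi _ _ mf.
rewrite invr_gt0 => /(_ d0) H; have := H (fun x => _); rewrite {H}.
move=> H; have {H} := H (fun x => powR_ge0 _ _).
rewrite invrK mulr0 !addr0 [d^-1 * pi]mulrC => H.
have E (t : R) : ((d^-1 * t + 0) ^+ 2 + 1) `^ (- (s / 2)) = d `^ s * rho d t `^ s.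
  have Z0 : 0 < d ^+ 2 + t ^+ 2 by rewrite ltr_wpDr ?sqr_ge0// exprn_gt0.
  have -> : (d^-1 * t + 0) ^+ 2 + 1 = (d * rho d t) ^- 2.
    rewrite /rho exprMn exprVn sqr_sqrtr ?ltW//; field; rewrite !gt_eqF//.
  have dr : 0 < d * rho d t by rewrite mulr_gt0// invr_gt0 sqrtr_gt0.
  by rewrite powR_invX2// powRM ?rho_ge0 ?(ltW d0).
have {}H : d `^ s * rho_integral d s = d *
    fine (\int[mu]_(x in `[0%R, (pi / d)%R[) ((x ^+ 2 + 1) `^ (- (s / 2)))%:E)%E.
  rewrite -[RHS]fineZ// -H rho_integral.unlock -[LHS]fineZ ?powR_gt0//; congr fine.
  rewrite -ge0_integralZl//.
  - by apply: eq_integral => t _; rewrite E EFinM.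
  - by apply: measurable_funTS; exact: measurable_rho_powR.
  - by move=> t _; rewrite lee_fin powR_ge0.
  - by rewrite lee_fin powR_ge0.
have {H} -> : fine (\int[mu]_(x in `[0%R, (pi / d)%R[) ((x ^+ 2 + 1) `^ (- (s / 2)))%:E)%E
    = d `^ (s - 1) * rho_integral d s.
  apply: (mulfI (negbT (gt_eqF d0))); rewrite -H mulrA; congr (_ * _).
  by rewrite -{2}[d]powRr1 ?(ltW d0)// -powRD ?subrKC// gt_eqF ?implybT.
rewrite powRM ?powR_ge0 ?rho_integral_ge0// -powRrM; congr (d `^ _ * _).
by rewrite mulrBl mulfV ?mul1r// gt_eqF.
Qed.

End rho_norm.

(** * Reduction to a dual norm *)

Section reduction.
Context {R : realType}.
Local Notation mu := (@lebesgue_measure R).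
Local Notation T := (2 * pi : R).

Lemma conjugate_cases (p p' : \bar R) : (1 <= p)%E -> (p^-1 + p'^-1 = 1)%E ->
  (p = 1%E /\ p' = +oo%E) \/
  exists s, [/\ 1 <= s, p' = s%:E & rinv p = 1 - s^-1].
Proof.
move=> p1 pp'.
have pNy : (-oo < p)%E by apply: lt_le_trans p1; exact: ltNyr.
have pn0 : p != 0%E by rewrite gt_eqF// (lt_le_trans _ p1).
move/(hoelder_conjugateP _ pNy pn0) : pp' => ->.
case: p p1 pNy pn0 => [q| |]//; last first.
  by move=> _ _ _; right; exists 1; rewrite hoelder_conjugatey /rinv invey /= invr1 subrr.
rewrite lee_fin => q1 _ _.
have [->|qn1] := eqVneq q 1; first by left; rewrite hoelder_conjugate1.
have {qn1}q1' : 1 < q by rewrite lt_neqAle eq_sym qn1.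
have q0 : 0 < q by exact: lt_trans q1'.
right; exists (q / (q - 1)); split.
- by rewrite ler_pdivlMr ?subr_gt0// mul1r gerBl.
- rewrite /hoelder_conjugate /= eqe gt_eqF// -EFinD inver subr_eq0.
  by rewrite gt_eqF.
- by rewrite /rinv inver gt_eqF//= invf_div mulrBl mulfV ?gt_eqF// mul1r subKr.
Qed.

Lemma mean0_ball_integrable (p : \bar R) phi : (1 <= p)%E -> mean0_ball p phi ->
  mu.-integrable `[- pi, pi] (EFin \o phi).
Proof.
move=> p1 [[pphi mphi _] phi1 _].
suff [L hL] : exists L : R, (\int[mu]_(t in `[0%R, T[) `|1 * phi t|%:E <= L%:E)%E.
  apply: (@Rintegral_period_le R phi L mphi pphi _).1.
  by under eq_integral do rewrite -[phi _]mul1r.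
have b1 : bounded_measurable (fun=> 1 : R) by exact: bounded_measurable_cst.
have pNy : (-oo < p)%E by apply: lt_le_trans p1; exact: ltNyr.
have pn0 : p != 0%E by rewrite gt_eqF// (lt_le_trans _ p1).
have pp' := hoelder_conjugate_eq1 pNy pn0.
have [[pE _]|[s [s1 p'E _]]] := conjugate_cases p1 pp'.
  exists 1; rewrite pE in phi1; apply: (@bounded_mul_L1_le R (fun=> 1)) => //.
  by move=> t; rewrite normr1.
rewrite p'E in pp'; exists (pnorm s (fun=> 1)).
exact: (holder_period p1 s1 pp' b1).
Qed.

Variables (al r beta : R) (n : nat).
Hypotheses (al0 : 0 < al) (r01 : 0 < r < 1) (n0 : (0 < n)%N).
Hypotheses (N14 : 14 <= Neps al r n) (d14 : dlt al r n <= 1 / 14).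
Local Notation w := (expcoef al r).
Local Notation b := (beta * pi / 2).
Local Notation e := (expR (- al * n%:R `^ r)).
Local Notation K := (scaled_tail al r n (- b)).

Let w0 := @expcoef_ge0 R al r.
Let cw : cvgn (series w). Proof. exact (@cvg_series_expcoef R al r n al0 r01 N14). Qed.

Lemma scaled_tailN c y : scaled_tail al r n c (- y) = scaled_tail al r n (- c) y.
Proof.
have H k : cos (k%:R * - y - c) = cos (k%:R * y - - c).
  by rewrite -cosN; congr cos; ring.
have E : cos_series w c (- y) = cos_series w (- c) y.
  congr (limn _); apply/funext => m; apply: eq_bigr => k _; by rewrite H.
rewrite /scaled_tail E; congr (_ * (_ - _)).
by apply: eq_bigr => k _; rewrite H.
Qed.

Lemma scaled_tail_periodic c : periodic (scaled_tail al r n c) T.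
Proof.
move=> t; rewrite /scaled_tail (cos_series_periodic w c); congr (_ * (_ - _)).
apply: eq_bigr => k _; congr (_ * _); rewrite mulrDr addrAC.
exact: cos_natr_shift.
Qed.

Lemma bounded_measurable_scaled_tail c : bounded_measurable (scaled_tail al r n c).
Proof.
apply: bounded_measurableM; first exact: bounded_measurable_cst.
apply: bounded_measurableB; first exact: (bounded_measurable_cos_series w0 cw).
apply: (@bounded_measurable_sum _ (fun k t => _)) => k.
apply: bounded_measurableM; first exact: bounded_measurable_cst.
exact: bounded_measurable_cos.
Qed.

(** Reflecting the kernel changes b to [- b] and leaves a translate in t: translation invariance of
    the norm handles every x, and [x = 0] gives [K] itself. *)
Lemma poisson_remainder phi a x : mu.-integrable `[- pi, pi] (EFin \o phi) ->
  let f x := a / 2 + pi^-1 * \int[mu]_(t in `[- pi, pi])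
               (poisson_kernel al r beta (x - t) * phi t) in
  f x - fourier_sum n.-1 f x =
  pi^-1 * e * \int[mu]_(t in `[- pi, pi]) (K (t - x) * phi t).
Proof.
move=> iphi f.
rewrite (@fourier_remainder R w w0 cw phi b a iphi n.-1 x) (prednK n0) -[RHS]mulrA; congr (_ * _).
have bK : bounded_measurable (fun t => K (t - x)).
  have := bounded_measurable_affine 1 (- x) (bounded_measurable_scaled_tail (- b)).
  by under eq_fun do rewrite mul1r.
rewrite -RintegralZl//; last exact: bounded_measurable_mul_integrable.
apply: eq_Rintegral => t _; rewrite mulrA; congr (_ * _).
rewrite -(scaled_tailN b (t - x)) opprB /scaled_tail mulrA -expRD.
by rewrite mulNr addNr expR0 mul1r.
Qed.

(** The lower bound needs one function and one point: [a0 = 0], the given [phi], and the origin. *)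
Lemma fourier_error_bounds (p : \bar R) Lo Up : (1 <= p)%E ->
  (forall phi x, mean0_ball p phi ->
    `|\int[mu]_(t in `[- pi, pi]) (K (t - x) * phi t)| <= Up) ->
  (exists2 phi, mean0_ball p phi &
    Lo <= `|\int[mu]_(t in `[- pi, pi]) (K t * phi t)|) ->
  exists2 E, fourier_error n al r beta p = E%:E &
    pi^-1 * e * Lo <= E <= pi^-1 * e * Up.
Proof.
move=> p1 HU [psi bpsi HL].
have e0 : 0 <= pi^-1 * e :> R by rewrite mulr_ge0 ?invr_ge0 ?pi_ge0 ?expR_ge0.
have U : (fourier_error n al r beta p <= (pi^-1 * e * Up)%:E)%E.
  apply: ge_ereal_sup => _ [f [pf [a [phi bphi fE]]] <-].
  apply: ge_ereal_sup => _ [x _ <-]; rewrite lee_fin.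
  have -> : f = fun x => a / 2 + pi^-1 * \int[mu]_(t in `[- pi, pi])
       (poisson_kernel al r beta (x - t) * phi t) by apply/funext => y; exact: fE.
  rewrite poisson_remainder; last exact: mean0_ball_integrable bphi.
  by rewrite normrM ger0_norm// ler_wpM2l// HU.
have L : ((pi^-1 * e * Lo)%:E <= fourier_error n al r beta p)%E.
  pose f (x : R) := 0 / 2 + pi^-1 * \int[mu]_(t in `[- pi, pi])
       (poisson_kernel al r beta (x - t) * psi t).
  have cf : poisson_class al r beta p f.
    split; last by exists 0, psi.
    move=> x; rewrite /f; congr (_ + _ * _); apply: eq_Rintegral => t _.
    by rewrite addrAC -[LHS]/(cos_series w b (x - t + T) * psi t) cos_series_periodic.
  apply: (@le_trans _ _ (normC (fun x => f x - fourier_sum n.-1 f x))); last first.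
    by apply: ereal_sup_ubound; exists f.
  apply: (@le_trans _ _ `|f 0 - fourier_sum n.-1 f 0|%:E); last first.
    by apply: ereal_sup_ubound; exists 0.
  rewrite poisson_remainder; last exact: mean0_ball_integrable bpsi.
  rewrite lee_fin normrM ger0_norm// ler_wpM2l//.
  by under eq_Rintegral do rewrite subr0.
case: (fourier_error _ _ _ _ _) U L => [E| |]//; rewrite !lee_fin => U L.
by exists E => //; rewrite L U.
Qed.

End reduction.

(** * Extremal functions *)

Section finite_exponent.
Context {R : realType}.
Local Notation mu := (@lebesgue_measure R).
Local Notation T := (2 * pi : R).

Lemma measurable_sgr : measurable_fun [set: R] (@Num.sg R).
Proof.
apply: nondecreasing_measurable => // x y xy.
case: (sgrP y) => y0; case: (sgrP x) => x0 //; lra.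
Qed.

(* Equality case of Hoelder's inequality, for the exponent conjugate to [s]. *)
Definition dual_power (c s x : R) : R := c * (Num.sg x * `|x| `^ (s - 1)).

Lemma dual_powerN c s x : dual_power c s (- x) = - dual_power c s x.
Proof. by rewrite /dual_power sgrN normrN mulNr mulrN. Qed.

Lemma measurable_dual_power c s : measurable_fun [set: R] (dual_power c s).
Proof.
apply: measurable_funM => //; apply: measurable_funM; first exact: measurable_sgr.
by apply: (@measurableT_comp _ _ _ _ _ _ (@powR R ^~ (s - 1))).
Qed.

Lemma dual_power_norm_le c s x : 0 <= c -> `|dual_power c s x| <= c * `|x| `^ (s - 1).
Proof.
move=> c0; rewrite !normrM (ger0_norm c0) ler_wpM2l// normr_sg.
rewrite [`|_ `^ _|]ger0_norm ?powR_ge0// ler_piMl ?powR_ge0//.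
by case: (x != 0); rewrite ?lexx ?ler01.
Qed.

Lemma mul_dual_power c s x : 0 < s -> x * dual_power c s x = c * `|x| `^ s.
Proof.
move=> s0; rewrite /dual_power mulrCA; congr (_ * _).
by rewrite mulrA [x * _]mulrC -normrEsg mulr_powRB1.
Qed.

Lemma bounded_measurable_comp (g f : R -> R) : bounded_measurable f ->
  measurable_fun [set: R] g -> (forall B, exists C, forall x, `|x| <= B -> `|g x| <= C) ->
  bounded_measurable (fun t => g (f t)).
Proof.
move=> [mf [B hB]] mg gb; split; first exact: measurableT_comp.
by have [C hC] := gb B; exists C => t; exact: hC.
Qed.

Lemma normLy_le1 (f : R -> R) : (forall t, `|f t| <= 1) -> (normL +oo f <= 1)%E.
Proof.
move=> f1; rewrite /normL Lnorm.unlock /=; case: ifPn => _; last exact: lee01.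
by apply/ess_supP; apply: nearW => t /=; rewrite lee_fin.
Qed.

Section extremal.
Variables (f : R -> R) (p : \bar R) (s : R).
Hypotheses (bf : bounded_measurable f) (pf : periodic f T).
Hypotheses (p1 : (1 <= p)%E) (s1 : 1 <= s) (ps : (p^-1 + s%:E^-1 = 1)%E).
Hypothesis odd0 : forall g : R -> R, measurable_fun [set: R] g ->
  (forall x, g (- x) = - g x) -> \int[mu]_(t in `[- pi, pi]) g (f t) = 0.

Let s0 : 0 < s. Proof. exact: lt_le_trans s1. Qed.
Let S := pow_integral s f.
(** Normalises the extremal function. For finite p = q, [(s - 1) q = s] and [(1 - 1/s) q = 1] give a
    q-norm of at most 1, also when [S = 0]; for infinite p, [s = 1] and [c = 1]. *)
Let c := S `^ (- (1 - s^-1)).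
Let phi t := dual_power c s (f t).

Let S0 : 0 <= S. Proof. exact: pow_integral_ge0. Qed.

Lemma bounded_measurable_extremal : bounded_measurable phi.
Proof.
apply: (bounded_measurable_comp bf); first exact: measurable_dual_power.
move=> B; exists (c * B `^ (s - 1)) => x xB.
apply: le_trans (dual_power_norm_le _ _ (powR_ge0 _ _)) _.
rewrite ler_wpM2l ?powR_ge0// ge0_ler_powR ?nnegrE ?subr_ge0//.
by rewrite (le_trans _ xB).
Qed.

Lemma normL_extremal : (normL p phi <= 1)%E.
Proof.
have c0 : 0 <= c by exact: powR_ge0.
case: p p1 ps => [q| |]// q1; last first.
  rewrite invey add0e inver gt_eqF// => -[s1'].
  have s1E : s = 1 by rewrite -[s]invrK s1' invr1.
  rewrite /phi /c; apply: normLy_le1 => t.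
  apply: le_trans (dual_power_norm_le _ _ c0) _.
  by rewrite /c s1E invr1 subrr oppr0 !powRr0 mulr1.
rewrite lee_fin in q1; have q0 : 0 < q by exact: lt_le_trans q1.
rewrite !inver !gt_eqF// -EFinD => -[qs].
have mphi := bounded_measurable_extremal.1.
rewrite pnormE ?(ltW q0)//; last exact: bounded_measurable_extremal.
have p1q : 1 `^ q^-1 = 1 :> R by rewrite powR1.
rewrite lee_fin pnorm.unlock -[X in _ <= X]p1q.
apply: ge0_ler_powR; rewrite ?nnegrE ?pow_integral_ge0 ?invr_ge0 ?(ltW q0)//.
have cq : c `^ q * S <= 1.
  have [->|Sn0] := eqVneq S 0; first by rewrite mulr0.
  have SP : 0 < S by rewrite lt_neqAle eq_sym Sn0.
  have qE : (1 - s^-1) * q = 1 by rewrite -qs addrK mulVf ?gt_eqF.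
  by rewrite /c -powRrM mulNr qE powR_inv1 ?(ltW SP)// mulVf.
apply: le_trans cq.
rewrite -lee_fin EFinM -(pow_integralE bounded_measurable_extremal (ltW q0)).
rewrite -(pow_integralE bf (ltW s0)) -ge0_integralZl//; last 2 first.
- by apply: measurable_funTS; apply: measurable_norm_powR; exact: bf.1.
- by rewrite lee_fin powR_ge0.
apply: ge0_le_integral => //.
- by apply: measurable_funTS; exact: measurable_norm_powR.
- apply: measurable_funTS; apply/measurable_EFinP; apply: measurable_funM => //.
  by apply/measurable_EFinP; apply: measurable_norm_powR; exact: bf.1.
- move=> t _; rewrite -EFinM lee_fin.
  apply: (@le_trans _ _ ((c * `|f t| `^ (s - 1)) `^ q)).
    apply: ge0_ler_powR; rewrite ?nnegrE ?mulr_ge0 ?powR_ge0 ?(ltW q0)//.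
    exact: dual_power_norm_le.
  rewrite powRM ?powR_ge0// -powRrM (_ : (s - 1) * q = s)//.
  have : (s - 1) * q = s * ((1 - s^-1) * q).
    by rewrite mulrA mulrBr mulr1 mulfV ?gt_eqF.
  by move=> ->; rewrite -qs addrK mulVf ?gt_eqF// mulr1.
Qed.

Lemma mean0_ball_extremal : mean0_ball p phi.
Proof.
split; first split.
- by move=> t; rewrite /phi pf.
- exact: bounded_measurable_extremal.1.
- by apply: le_lt_trans normL_extremal _; exact: ltry.
- exact: normL_extremal.
- apply: odd0; first exact: measurable_dual_power.
  by move=> x; exact: dual_powerN.
Qed.

Lemma integral_extremal :
  \int[mu]_(t in `[- pi, pi]) (f t * phi t) = pnorm s f.
Proof.
have -> : \int[mu]_(t in `[- pi, pi]) (f t * phi t) =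
    \int[mu]_(t in `[- pi, pi]) (c * `|f t| `^ s).
  by apply: eq_Rintegral => t _; exact: mul_dual_power.
have mfs := measurable_norm_powR s bf.1.
have E : (\int[mu]_(t in `[(- pi)%R, pi%R]) (`|f t| `^ s)%:E = S%:E)%E.
  rewrite ge0_integral_sym_period//; last by move=> t; rewrite pf.
  by rewrite pow_integralE// ltW.
rewrite RintegralZl//; last first.
  apply/integrableP; split; first exact: measurable_funTS.
  under eq_integral do rewrite gee0_abs ?lee_fin ?powR_ge0//.
  by rewrite E ltry.
rewrite /Rintegral E /= pnorm.unlock -/S /c.
have [->|Sn0] := eqVneq S 0; first by rewrite mulr0 powR0// invr_eq0 gt_eqF.
rewrite -{2}[S]powRr1// -powRD ?Sn0 ?implybT//; congr powR; ring.
Qed.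

End extremal.
End finite_exponent.

(** * Error estimates *)

Lemma sub_le_norm_add (R : realType) (a c y z : R) :
  a <= y -> `|z| <= c -> a - c <= `|y + z|.
Proof.
by rewrite ler_norml => ? /andP[? _]; apply: le_trans (ler_norm _); lra.
Qed.

Section error_estimates.
Context {R : realType}.
Local Notation mu := (@lebesgue_measure R).
Local Notation T := (2 * pi : R).

Lemma pnorm_shift s (f : R -> R) c : bounded_measurable f -> periodic f T ->
  pnorm s (fun t => f (t + c)) = pnorm s f.
Proof.
move=> bf pf; rewrite pnorm.unlock pow_integral.unlock.
rewrite (@ge0_integral_periodic_shift R T period_gt0 (fun t => (`|f t| `^ s)%:E))//.
- by apply: measurable_norm_powR; exact: bf.1.
- by move=> x; rewrite pf.
Qed.

Lemma bounded_measurable_cos1 : bounded_measurable (@cos R).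
Proof. by have := @bounded_measurable_cos R 1 0; under eq_fun do rewrite mul1r addr0. Qed.

Lemma pnorm_cos_le s : 1 <= s -> pnorm s (@cos R) <= T `^ s^-1.
Proof.
move=> s1; have s0 : 0 < s by exact: lt_le_trans s1.
have <- : pnorm s (fun=> 1 : R) = T `^ s^-1.
  by rewrite pnorm.unlock pow_integral_cst// powR1 mul1r.
apply: (le_pnorm s0 bounded_measurable_cos1 (bounded_measurable_cst 1)).
by move=> t _; rewrite normr1 cos_max.
Qed.

Variables (al r beta : R) (n : nat).
Hypotheses (al0 : 0 < al) (r01 : 0 < r < 1) (n0 : (0 < n)%N).
Hypotheses (N14 : 14 <= Neps al r n) (d14 : dlt al r n <= 1 / 14).
Local Notation d := (dlt al r n).
Local Notation N := (Neps al r n).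
Local Notation q := (expR (- d)).
Local Notation b := (beta * pi / 2).
Local Notation e := (expR (- al * n%:R `^ r)).
Local Notation K := (scaled_tail al r n (- b)).
Local Notation M := (cell_wave q n (- b)).

Let q01 : 0 < q < 1. Proof. exact: ratio01. Qed.
Let d0 : 0 < d. Proof. exact: dlt_gt0. Qed.
Let N0 : 0 < N. Proof. by move: N14; lra. Qed.
Let bK : bounded_measurable K. Proof. exact: bounded_measurable_scaled_tail. Qed.
Let bM : bounded_measurable M. Proof. exact: bounded_measurable_cell_wave. Qed.
Let pM : periodic M T. Proof. exact: cell_wave_periodic. Qed.
Let pK : periodic K T. Proof. exact: scaled_tail_periodic. Qed.
Let bA : bounded_measurable (amp q). Proof. exact: bounded_measurable_amp. Qed.

Let bB : bounded_measurable (fun t => amp q (cell_start n t)).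
Proof. exact: bounded_measurable_amp_cell. Qed.

Let odd_integral (g : R -> R) : measurable_fun [set: R] g ->
  (forall x, g (- x) = - g x) -> \int[mu]_(t in `[- pi, pi]) g (M t) = 0.
Proof. by move=> mg go; exact: integral_odd_cell_wave. Qed.

Let sub_integral phi : mu.-integrable `[- pi, pi] (EFin \o phi) ->
  \int[mu]_(t in `[- pi, pi]) (K t * phi t) =
  \int[mu]_(t in `[- pi, pi]) (M t * phi t) +
  \int[mu]_(t in `[- pi, pi]) ((K t - M t) * phi t).
Proof.
move=> iphi; rewrite -RintegralD//; last 2 first.
- exact: bounded_measurable_mul_integrable.
- by apply: bounded_measurable_mul_integrable => //; exact: bounded_measurableB.
by apply: eq_Rintegral => t _; rewrite -mulrDl subrKC.
Qed.

Let err t : `|K t - M t| <= 5 + 74 * (amp q t / N).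
Proof. exact: scaled_tail_cell_wave. Qed.

Lemma finite_exponent_estimate (p : \bar R) s :
  (1 <= p)%E -> 1 <= s -> (p^-1 + s%:E^-1 = 1)%E ->
  let X := rho_integral d s `^ s^-1 in
  exists2 E, fourier_error n al r beta p = E%:E &
    `|E - pi^-1 * e * (pnorm s cos / T `^ s^-1 * (2 `^ s^-1 * X))| <=
    pi^-1 * e * (646 + 184 * (X / N)).
Proof.
move=> p1 s1 ps X; have s0 : 0 < s by exact: lt_le_trans s1.
pose nK := pnorm s K; pose nM := pnorm s M; pose nA := pnorm s (amp q).
pose nB := pnorm s (fun t => amp q (cell_start n t)).
pose nR := 2 `^ s^-1 * X.
pose kap := pnorm s (@cos R) / T `^ s^-1.
have Ts0 : 0 < T `^ s^-1 by rewrite powR_gt0// period_gt0.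
have kap0 : 0 <= kap by rewrite divr_ge0 ?pnorm_ge0// ltW.
have kap1 : kap <= 1 by rewrite ler_pdivrMr// mul1r pnorm_cos_le.
have bc c : bounded_measurable (fun=> c : R) by exact: bounded_measurable_cst.
have bcA c : bounded_measurable (fun t => c * amp q t) by exact: bounded_measurableM.
have nA0 : 0 <= nA by exact: pnorm_ge0.
have nMB : nM = kap * nB by exact: pnorm_cell_wave.
have BA : `|nB - nA| <= 18 / N * nA.
  rewrite -(pnormZ _ s0 bA) ?divr_ge0 ?(ltW N0)//.
  apply: pnorm_dist => // t _; rewrite distrC mulrAC -mulrA.
  exact: amp_cell_start.
have AR : `|nA - nR| <= 80.
  rewrite /nR /X -(pnorm_rho_fold d0 s1).
  apply: (@le_trans _ _ (pnorm s (fun=> 10 : R))).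
    apply: pnorm_dist => //; first exact: bounded_measurable_rho_fold.
    by move=> t; exact: amp_rho_fold.
  by apply: le_trans (pnorm_cst_le _ s1) _ => //; lra.
pose err1 t : R := 5 + 74 / N * amp q t.
have berr1 : bounded_measurable err1 by exact: bounded_measurableD.
have err1E t : `|K t - M t| <= err1 t.
  by apply: le_trans (err t) _; rewrite /err1 mulrAC -mulrA.
have nerr : pnorm s err1 <= 40 + 74 / N * nA.
  apply: le_trans (ler_pnormD s1 (bc 5) (bcA _)) _.
  rewrite (pnormZ _ s0 bA) ?divr_ge0 ?(ltW N0)// lerD2r.
  by apply: le_trans (pnorm_cst_le _ s1) _ => //; lra.
have KM : `|nK - nM| <= pnorm s err1 by apply: pnorm_dist.
have HU phi x : mean0_ball p phi ->
    `|\int[mu]_(t in `[- pi, pi]) (K (t - x) * phi t)| <= nK.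
  move=> [[pphi mphi _] phi1 _]; rewrite /nK -(pnorm_shift s (- x) bK pK).
  have bKx : bounded_measurable (fun t => K (t - x)).
    have := bounded_measurable_affine 1 (- x) bK.
    by under eq_fun do rewrite mul1r.
  apply: (Rintegral_period_le _ _ (holder_period p1 s1 ps bKx mphi phi1)).2.
    by apply: measurable_funM => //; exact: bKx.1.
  by move=> t; rewrite pphi addrAC pK.
have HL : exists2 phi, mean0_ball p phi &
    nM - pnorm s err1 <= `|\int[mu]_(t in `[- pi, pi]) (K t * phi t)|.
  have bphi := mean0_ball_extremal bM pM p1 s1 ps odd_integral.
  have iphi := mean0_ball_integrable p1 bphi.
  eexists; first exact: bphi.
  rewrite sub_integral// integral_extremal// -/nM.
  apply: sub_le_norm_add (lexx nM) _.
  have bKM := bounded_measurableB bK bM.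
  apply: (@le_trans _ _ (pnorm s (fun t => K t - M t))).
    have [[pphi mphi _] phi1 _] := bphi.
    apply: (Rintegral_period_le _ _ (holder_period p1 s1 ps bKM mphi phi1)).2.
      by apply: measurable_funM => //; exact: bKM.1.
    by move=> t; rewrite pphi pK pM.
  apply: le_pnorm => // t _; apply: le_trans (err1E t) (ler_norm _).
have [E EE /andP[EL EU]] := fourier_error_bounds al0 r01 n0 N14 p1 HU HL.
exists E => //.
have e0 : 0 < pi^-1 * e :> R by rewrite mulr_gt0 ?invr_gt0 ?pi_gt0 ?expR_gt0.
(* Tail to wave costs [40 + 74 nA / N], wave to [kap * nR] costs [80 + 18 nA / N]. With
   [nA / N <= 2 X / N + 80/14] the total is below [646 + 184 X / N], as [92 * 2 = 184] and
   [120 + 92 * 80/14 < 646]. *)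
suff [h1 h2] : nK <= kap * nR + (646 + 184 * (X / N)) /\
    kap * nR - (646 + 184 * (X / N)) <= nM - pnorm s err1.
  rewrite ler_distl -mulrBr -mulrDr; apply/andP; split.
    by apply: le_trans EL; rewrite ler_pM2l.
  by apply: le_trans EU _; rewrite ler_pM2l.
have X0 : 0 <= X by exact: powR_ge0.
have R2 : nR <= 2 * X.
  rewrite ler_wpM2r//; have s10 : s^-1 <= 1 by rewrite invf_le1.
  by apply: ler1_powR => //; rewrite ler1n.
move: KM BA AR; rewrite !ler_norml => /andP[_ KM] /andP[BA1 BA2] /andP[AR1 AR2].
have iN : N^-1 <= 1 / 14 by rewrite ler_pdivlMr// mulrC ler_pdivrMr// mul1r.
have iN0 : 0 < N^-1 by rewrite invr_gt0.
have dB : `|nM - kap * nR| <= 18 / N * nA + 80.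
  rewrite nMB -mulrBr normrM (ger0_norm kap0).
  apply: le_trans (_ : 1 * `|nB - nR| <= _); first by rewrite ler_wpM2r.
  by rewrite mul1r ler_norml; apply/andP; split; lra.
have nAX : nA / N <= 2 * (X / N) + 80 / 14.
  rewrite -lerBlDl mulrA -mulrBl.
  apply: (@le_trans _ _ (80 / N)); first by rewrite ler_pM2r//; lra.
  by rewrite ler_pM2l//; lra.
move: dB; rewrite ler_norml => /andP[dB1 dB2].
have eqA c : c / N * nA = c * (nA / N) by rewrite mulrAC mulrA.
rewrite !eqA in dB1 dB2 nerr.
by split; lra.
Qed.

Let amp_ub t : amp q t <= d^-1 + 1.
Proof.
have [_ q1 h] := expRN_bounds d0.
apply: le_trans (amp_le q01 t) _; rewrite -div1r ler_pdivrMr ?subr_gt0//.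
have -> : d^-1 + 1 = (1 + d) / d by field; rewrite gt_eqF.
by rewrite mulrAC ler_pdivlMr// mul1r.
Qed.

Let amp0_lb : d^-1 <= amp q 0.
Proof.
have [h q1 _] := expRN_bounds d0.
have -> : amp q 0 = (1 - q)^-1.
  rewrite /amp den_norm2E cos0 subrr mulr0 addr0 sqrtr_sqr ger0_norm// subr_ge0.
  exact: ltW.
by rewrite lef_pV2 ?posrE ?subr_gt0//; lra.
Qed.

(* [amp q 0] is the supremum of [|M|]; staying slightly below it gives
   [{|M| >= lam}] positive measure. *)
Let lam : R := (1 - N^-1) * amp q 0.
Let above (x : R) : R := ((lam <= `|x|)%R)%:R.

Let measurable_above : measurable_fun [set: R] above.
Proof.
apply: (@measurableT_comp _ _ _ _ _ _ (fun x : R => ((lam <= x)%R)%:R : R)) => //.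
apply: nondecreasing_measurable => // x y xy; rewrite ler_nat.
by case: (leP lam x) => // lx; rewrite (le_trans lx xy).
Qed.

Let above_ge0 x : 0 <= above x. Proof. exact: ler0n. Qed.

Let above_le1 x : above x <= 1. Proof. by rewrite lern1 leq_b1. Qed.

Let lam_ge0 : 0 <= lam.
Proof.
rewrite mulr_ge0 ?(ltW (amp_gt0 q01 _))// subr_ge0 invf_le1//.
by move: N14; lra.
Qed.

Let bounded_measurable_above : bounded_measurable (fun t => above (M t)).
Proof.
split; first by apply: measurableT_comp => //; exact: bM.1.
by exists 1 => t; rewrite ger0_norm.
Qed.

(** The first cell suffices: its frozen amplitude is [amp q 0], and [cos u >= 1 - u^2 >= 1 - 1/N]
    for u in [[0, 1/N[]. Only positivity is used later, to divide by the measure of the level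
    set. *)
Let integral_above_ge :
  ((n%:R^-1 * N^-1)%:E <= \int[mu]_(t in `[0%R, T[) (above (M t))%:E)%E.
Proof.
rewrite (@integral_cell_wave R q (- b) n q01 n0 (fun x => (above x)%:E)).
- have iN0 : 0 < N^-1 by rewrite invr_gt0.
  have iN : N^-1 <= 1 / 14 by rewrite ler_pdivlMr// mulrC ler_pdivrMr// mul1r.
  rewrite (bigD1 (Ordinal n0))//= mul0r.
  set F := (X in (_ <= _ * X + _)%E).
  have FN : ((N^-1)%:E <= F)%E.
    have mF : measurable_fun [set: R] (fun u : R => (above (amp q 0 * cos u))%:E).
      apply/measurable_EFinP; apply: measurableT_comp => //.
      by apply: measurable_funM => //; exact: bounded_measurable_cos1.1.
    have -> : (N^-1)%:E = (\int[mu]_(u in `[0%R, (N^-1)%R[) 1%:E)%E.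
      rewrite (integral_cst mu (measurable_itv _) 1%:E) /= lebesgue_measure_itv/=.
      by rewrite lte_fin iN0 sube0 mul1e.
    apply: (@le_trans _ _ (\int[mu]_(u in `[0%R, (N^-1)%R[) (above (amp q 0 * cos u))%:E)%E).
      apply: ge0_le_integral => //.
      - exact: measurable_funTS.
      - move=> u /=; rewrite in_itv/= => /andP[u0 uN]; rewrite lee_fin /above.
        suff -> : lam <= `|amp q 0 * cos u| by [].
        apply: le_trans (ler_norm _); rewrite /lam mulrC ler_pM2l ?amp_gt0//.
        have := one_sub_cos_le u; have : u ^+ 2 <= N^-1 by nra.
        lra.
    apply: (@ge0_subset_integral _ _ _ mu _ _ (measurable_itv _) (measurable_itv _)).
    + exact: measurable_funTS mF.
    + by move=> u _; rewrite lee_fin.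
    + move=> u /=; rewrite !in_itv/= => /andP[-> uN] /=.
      by rewrite (lt_trans uN)//; have := @pi_ge2 R; lra.
  apply: (@le_trans _ _ ((n%:R^-1)%:E * F)%E).
    by rewrite EFinM lee_wpmul2l.
  apply: leeDl; apply: sume_ge0 => k _; rewrite mule_ge0// ?lee_fin//.
  by apply: integral_ge0 => u _; rewrite lee_fin.
- exact/measurable_EFinP.
- by move=> x; rewrite lee_fin.
Qed.

Lemma one_exponent_estimate :
  exists2 E, fourier_error n al r beta 1 = E%:E &
    `|E - pi^-1 * e * d^-1| <= pi^-1 * e * (12 + 75 * (d^-1 / N)).
Proof.
have iN0 : 0 < N^-1 by rewrite invr_gt0.
have iN : N^-1 <= 1 / 14 by rewrite ler_pdivlMr// mulrC ler_pdivrMr// mul1r.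
have id0 : 0 < d^-1 by rewrite invr_gt0.
have errN t : `|K t - M t| <= 5 + 74 * ((d^-1 + 1) / N).
  by apply: le_trans (err t) _; rewrite lerD2l ler_pM2l// ler_pM2r.
have Mle t : `|M t| <= d^-1 + 1.
  rewrite normrM (ger0_norm (ltW (amp_gt0 q01 _))).
  apply: le_trans (amp_ub (cell_start n t)); rewrite ler_piMr ?cos_max//.
  exact: ltW (amp_gt0 q01 _).
pose Up := d^-1 + 1 + (5 + 74 * ((d^-1 + 1) / N)).
have Kle t : `|K t| <= Up.
  by rewrite -(subrKC (M t) (K t)) (le_trans (ler_normD _ _))// lerD.
have HU phi x : mean0_ball 1 phi ->
    `|\int[mu]_(t in `[- pi, pi]) (K (t - x) * phi t)| <= Up.
  move=> [[pphi mphi _] phi1 _].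
  have bKx : bounded_measurable (fun t => K (t - x)).
    have := bounded_measurable_affine 1 (- x) bK.
    by under eq_fun do rewrite mul1r.
  apply: (Rintegral_period_le _ _ (bounded_mul_L1_le bKx.1 _ mphi phi1)).2 => //.
    by apply: measurable_funM => //; exact: bKx.1.
  by move=> t; rewrite pphi addrAC pK.
pose m := fine (\int[mu]_(t in `[0%R, T[) (above (M t))%:E)%E.
have mE : (\int[mu]_(t in `[0%R, T[) (above (M t))%:E = m%:E)%E.
  rewrite fineK// ge0_fin_numE; last by apply: integral_ge0 => t _; rewrite lee_fin.
  apply: (@le_lt_trans _ _ (\int[mu]_(t in `[0%R, T[) 1%:E)%E).
    apply: ge0_le_integral => //.
    - by move=> t _; rewrite lee_fin.
    - by apply: measurable_funTS; apply/measurable_EFinP; exact: bounded_measurable_above.1.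
    - by move=> t _; rewrite lee_fin.
  by rewrite integral_period_cst ltry.
have m0 : 0 < m.
  have := integral_above_ge; rewrite mE lee_fin; apply: lt_le_trans.
  by rewrite mulr_gt0// invr_gt0 ltr0n.
pose g (x : R) := m^-1 * (Num.sg x * above x).
pose phi t := g (M t).
have mg : measurable_fun [set: R] g.
  by apply: measurable_funM => //; apply: measurable_funM => //; exact: measurable_sgr.
have mphi : measurable_fun [set: R] phi by apply: measurableT_comp => //; exact: bM.1.
have phi_le t : `|phi t| <= m^-1 * above (M t).
  rewrite !normrM (ger0_norm (ltW _)) ?invr_gt0// ler_pM2l ?invr_gt0//.
  rewrite (ger0_norm (above_ge0 _)) ler_piMl// normr_sg.
  by case: (_ != 0); rewrite ?lexx ?ler01.
have phi1 : (normL 1 phi <= 1)%E.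
  rewrite normL1E//.
  have -> : 1%E = (\int[mu]_(t in `[0%R, T[) (m^-1 * above (M t))%:E)%E :> \bar R.
    under eq_integral do rewrite EFinM.
    rewrite ge0_integralZl//.
    - by rewrite [X in (_ * X)%E]mE -EFinM mulVf// gt_eqF.
    - by apply: measurable_funTS; apply/measurable_EFinP; exact: bounded_measurable_above.1.
    - by move=> t _; rewrite lee_fin.
    - by rewrite lee_fin invr_ge0 ltW.
  apply: ge0_le_integral => //.
  - by apply: measurable_funTS; apply/measurable_EFinP; exact: measurableT_comp.
  - apply: measurable_funTS; apply/measurable_EFinP; apply: measurable_funM => //.
    exact: bounded_measurable_above.1.
  - by move=> t _; rewrite lee_fin.
have bphi : mean0_ball 1 phi.
  split; first split=> //.
  - by move=> t; rewrite /phi pM.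
  - by apply: le_lt_trans phi1 _; exact: ltry.
  - exact: phi1.
  - apply: (odd_integral mg) => x.
    by rewrite /g sgrN /above normrN mulNr mulrN.
have iphi := mean0_ball_integrable (lexx 1%E) bphi.
have HL : exists2 phi, mean0_ball 1 phi &
    lam - (5 + 74 * ((d^-1 + 1) / N)) <=
    `|\int[mu]_(t in `[- pi, pi]) (K t * phi t)|.
  exists phi => //; rewrite sub_integral//.
  (* On the level set, of measure m, the product is [|M| / m >= lam / m]; elsewhere it vanishes. *)
  have h1 : lam <= \int[mu]_(t in `[- pi, pi]) (M t * phi t).
    have -> : lam = \int[mu]_(t in `[- pi, pi]) (lam * m^-1 * above (M t)).
      rewrite RintegralZl//; last first.
        exact: (bounded_measurable_integrable _ _ bounded_measurable_above).
      rewrite /Rintegral ge0_integral_sym_period.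
      - by rewrite [X in fine X]mE/= mulfVK// gt_eqF.
      - by apply/measurable_EFinP; exact: bounded_measurable_above.1.
      - by move=> t; rewrite lee_fin.
      - by move=> t; rewrite pM.
    apply: le_Rintegral => //.
    - apply: (bounded_measurable_integrable _ _
        (bounded_measurableM (bounded_measurable_cst _) bounded_measurable_above)).
    - exact: bounded_measurable_mul_integrable.
    - move=> t _; have -> : M t * phi t = m^-1 * (`|M t| * above (M t)).
        by rewrite /phi /g [`|_|]normrEsg; ring.
      rewrite -mulrA mulrCA ler_pM2l ?invr_gt0// /above.
      by case: (leP lam) => [h|_]; rewrite ?mulr1 ?mulr0.
  apply: sub_le_norm_add h1 _.
  have bKM := bounded_measurableB bK bM.
  apply: (Rintegral_period_le _ _ (bounded_mul_L1_le bKM.1 errN mphi phi1)).2.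
    by apply: measurable_funM => //; exact: bKM.1.
  by move=> t; rewrite /phi pK pM.
have [E EE /andP[EL EU]] := fourier_error_bounds al0 r01 n0 N14 (lexx 1%E) HU HL.
exists E => //.
have e0 : 0 < pi^-1 * e :> R by rewrite mulr_gt0 ?invr_gt0 ?pi_gt0 ?expR_gt0.
have lam_lb : d^-1 - d^-1 / N <= lam.
  have -> : d^-1 - d^-1 / N = (1 - N^-1) * d^-1 by ring.
  by rewrite ler_wpM2l// subr_ge0; move: iN; lra.
have dN : (d^-1 + 1) / N = d^-1 / N + N^-1 by rewrite mulrDl mul1r.
have dN0 : 0 <= d^-1 / N by rewrite divr_ge0 ?ltW.
(* In the upper bound 12 covers [1 + 5 + 74/14]; in the lower bound [75 = 74 + 1], the unit being
   the loss in [lam]. *)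
rewrite ler_distl -mulrBr -mulrDr; apply/andP; split.
  by apply: le_trans EL; rewrite ler_pM2l// dN; lra.
by apply: le_trans EU _; rewrite ler_pM2l// /Up dN; lra.
Qed.

End error_estimates.

(** * The exponent p = 1 and the constants *)

Section endpoint_exponent.
Context {R : realType}.
Local Notation mu := (@lebesgue_measure R).

(** Serves both [|cos t|] and [(t^2 + 1)^(-1/2)]. The quadratic lower bound makes f exceed any level
    below 1 on an interval [[0, h[] of positive measure. *)
Lemma ess_sup_peak (D : set R) (mD : measurable D) (v : R) (f : R -> R) :
  0 < v -> `[0, v[ `<=` D -> (forall t, f t <= 1) ->
  (forall t, 1 - t ^+ 2 <= f t) ->
  ess_sup (mrestr mu mD) (EFin \o f) = 1%E.
Proof.
move=> v0 vD f1 fge; apply/eqP; rewrite eq_le; apply/andP; split.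
  by apply/ess_supP; apply: nearW => t /=; rewrite lee_fin.
apply/lee_subgt0Pr => e e0.
(* [h <= 1] and [h <= e] give [h^2 <= e]; [h <= v] keeps the interval inside D. *)
pose h := Num.min v (Num.min 1 e).
have h0 : 0 < h by rewrite !lt_min v0 ltr01.
have he : h ^+ 2 <= e.
  have [hv h1 hE] : [/\ h <= v, h <= 1 & h <= e].
    by split; rewrite !ge_min lexx ?orbT.
  by rewrite expr2 (le_trans _ hE)// ler_piMl ?(ltW h0).
rewrite leNgt; apply/negP => lt_sup.
have [Z [mZ Z0 subZ]] := ess_sup_ge (mrestr mu mD) (EFin \o f).
have hZ : `[0, h[ `<=` Z `&` D.
  move=> t /=; rewrite in_itv/= => /andP[t0 th]; split; last first.
    by apply: vD => /=; rewrite in_itv/= t0 (lt_le_trans th)// ge_min lexx.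
  apply: subZ => /= ft; have := le_lt_trans ft lt_sup.
  rewrite -EFinB lte_fin => ft1; have := fge t.
  have th2 : t ^+ 2 <= h ^+ 2 by rewrite lerXn2r ?nnegrE// ltW.
  by move: th2 he ft1; lra.
have mZD : measurable (Z `&` D) by exact: measurableI.
have : (mu `[0%R, h[%classic <= 0)%E.
  rewrite -[leRHS]Z0.
  by apply: (le_measure _ _ (mem_set mZD) hZ); rewrite inE.
by rewrite lebesgue_measure_itv/= lte_fin h0 sube0 lee_fin leNgt h0.
Qed.

Lemma normL_pinfty_cos : normL +oo%E (cos : R -> R) = 1%E.
Proof.
have T0 : 0 < 2 * pi :> R by rewrite mulr_gt0 ?pi_gt0.
rewrite /normL Lnorm.unlock /= ifT; last first.
  rewrite /period_measure /mrestr setTI lebesgue_measure_itv/= lte_fin T0 sube0.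
  by rewrite lte_fin.
apply: (@ess_sup_peak _ _ (2 * pi) (fun t => `|cos t|)) => //.
- by move=> t; rewrite cos_max.
- move=> t; have := one_sub_cos_le t; have := ler_norm (cos t); lra.
Qed.

Lemma J_pinfty (v : R) : 0 < v -> J +oo%E v = 1.
Proof.
move=> v0; rewrite /J.
rewrite (@ess_sup_peak _ _ v (fun t => (t ^+ 2 + 1) `^ (- (1 / 2))))//.
- by move=> t; rewrite /= !in_itv/= => /andP[-> /ltW].
- move=> t; have t1 : 1 <= t ^+ 2 + 1 by rewrite lerDr sqr_ge0.
  by rewrite -[leRHS](powRr0 (t ^+ 2 + 1)) ler_powR//; lra.
move=> t; have t2 := sqr_ge0 t; have t1 : 1 <= t ^+ 2 + 1 by rewrite lerDr.
apply: (@le_trans _ _ ((t ^+ 2 + 1) `^ (-1))); last by rewrite ler_powR//; lra.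
rewrite powR_inv1; last by rewrite (le_trans _ t1).
rewrite -[leRHS]mul1r ler_pdivlMr; last by rewrite (lt_le_trans _ t1).
by move: t2; set y := t ^+ 2; nra.
Qed.

End endpoint_exponent.

(** * From the threshold to bounds on N and d, and the value of gamma *)

Section threshold.
Context {R : realType}.
Implicit Types (alpha r : R) (p : \bar R).

Lemma powRD_gt0 (x r s : R) : 0 < x -> x `^ (r + s) = x `^ r * x `^ s.
Proof. by move=> x0; rewrite powRD// (gt_eqF x0) implybT. Qed.

Lemma powR_sub1 (x r : R) : 0 < x -> x `^ (1 - r) = x / x `^ r.
Proof. by move=> x0; rewrite powRD_gt0// powRN powRr1// ltW. Qed.

Lemma kappa_le p : (1 <= p)%E -> kappa p <= 1 / 14.
Proof.
have pi2 := pi_ge2 R.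
have k : 1 / (3 * pi) ^+ 3 <= 1 / 14 :> R.
  rewrite !div1r lef_pV2 ?posrE// ?exprn_gt0 ?mulr_gt0 ?pi_gt0//.
  have : 6 <= 3 * pi :> R by move: pi2; lra.
  move=> h; apply: (@le_trans _ _ (6 ^+ 3)); first by lra.
  by rewrite lerXn2r ?nnegrE//; lra.
case: p => [q| |]//=; rewrite lee_fin => q1.
case: eqP => // _; apply: le_trans k.
have q0 : 0 < q := lt_le_trans ltr01 q1.
rewrite ler_piMr ?divr_ge0 ?exprn_ge0 ?mulr_ge0 ?pi_ge0//.
by rewrite ler_pdivrMr// mul1r gerBl.
Qed.

(** The two summands of the threshold condition are [1 / N] and [chi p * d], with [chi p >= 1], so
    each of [1 / N] and d is at most 1/14 at [n0]. Then N increases with n and d decreases. *)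
Lemma n0_le_bounds alpha r p n : 0 < alpha -> 0 < r < 1 -> (1 <= p)%E ->
  (n0 alpha r p <= n)%N ->
  [/\ (0 < n)%N, 14 <= Neps alpha r n & dlt alpha r n <= 1 / 14].
Proof.
move=> al0 r01 p1 n_ge; have /andP[r0 r1] := r01.
have [m0 cm _] := n0P al0 r01 p1; move: m0 cm n_ge.
set m := n0 _ _ _ => m0 cm mn.
have ar0 : 0 < alpha * r by rewrite mulr_gt0.
have npos : (0 < n)%N := leq_trans m0 mn.
have mR : 0 < m%:R :> R by rewrite ltr0n.
have nR : 0 < n%:R :> R by rewrite ltr0n.
have mnR : m%:R <= n%:R :> R by rewrite ler_nat.
have chi1 : 1 <= chi p by case: (p) p1 => [q| |]//=; rewrite lee_fin.
have pm : 0 < m%:R `^ r :> R := powR_gt0 _ mR.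
have qm : 0 < m%:R `^ (1 - r) :> R := powR_gt0 _ mR.
have k := kappa_le p1.
move: cm; rewrite /n0_cond; set A := (X in X + _); set B := (X in _ + X) => cm.
have A0 : 0 <= A by rewrite /A !mulr_ge0 ?invr_ge0 ?ltW.
have B0 : 0 <= B by rewrite /B !mulr_ge0 ?invr_ge0 ?(ltW r0) ?(ltW al0) ?(ltW qm) ?(le_trans ler01).
have Nm : 14 <= Neps alpha r m.
  have : (Neps alpha r m)^-1 <= 14^-1.
    apply: (@le_trans _ _ A); last by lra.
    by rewrite /A /Neps !div1r invfM.
  by rewrite lef_pV2 ?posrE// /Neps mulr_gt0.
have dm : dlt alpha r m <= 1 / 14.
  apply: (@le_trans _ _ B); last by lra.
  rewrite /B /dlt powR_sub1//.
  rewrite invf_div -!mulrA ler_pM2l// ler_pM2l// ler_peMl//.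
split=> //.
  apply: le_trans Nm _; rewrite /Neps ler_pM2l//.
  by apply: ge0_ler_powR => //; rewrite ?nnegrE ltW.
by apply: le_trans dm; rewrite /dlt ler_pM2l//; exact: powR_div_le.
Qed.

(** Here x is n, a is [alpha * r], sg is [1/p], tau is [1/p'], and X is the main norm without its
    constants. *)
Lemma error_form (x a r sg tau C Jv X E e : R) :
  0 < x -> 0 < a -> 0 < e -> 0 <= X -> x `^ ((1 - r) * sg) / a `^ sg * Jv = X ->
  `|E - pi^-1 * e * (C / pi `^ tau * X)| <=
    pi^-1 * e * (646 + 184 * (X / (a * x `^ r))) ->
  exists gamma : R, `|gamma| <= (14 * pi) ^+ 2 /\
    E = e * x `^ ((1 - r) * sg) *
     (C / (pi `^ (1 + tau) * a `^ sg) * Jv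
      + gamma * (1 / a `^ (1 + sg) * Jv * (1 / x `^ r)
         + 1 / x `^ ((1 - r) * sg))).
Proof.
have [Pi [<- pi2]] : exists Pi : R, Pi = pi /\ 2 <= Pi by exists pi; rewrite pi_ge2.
have pi0 : 0 < Pi by rewrite (lt_le_trans _ pi2).
move=> x0 a0 e0 X0 XE.
rewrite !powRD_gt0// !powRr1 ?(ltW a0) ?(ltW pi0)//.
have c1 : 0 < x `^ ((1 - r) * sg) := powR_gt0 _ x0.
have as0 : 0 < a `^ sg := powR_gt0 _ a0.
have xr : 0 < x `^ r := powR_gt0 _ x0.
have pt : 0 < Pi `^ tau :> R := powR_gt0 _ pi0.
move: c1 as0 xr pt XE; set c := x `^ (_ * _); set b := a `^ sg.
set y := x `^ r; set w := Pi `^ tau => c1 as0 xr pt XE.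
clearbody c b y w.
set N := a * y => bound.
have N0 : 0 < N by rewrite mulr_gt0.
have D0 : 0 < X / N + 1 by rewrite ltr_wpDl// divr_ge0// ltW.
exists ((E / e - C / (Pi * w) * X) / (X / N + 1)); split.
  rewrite normrM normfV (gtr0_norm D0) ler_pdivrMr//.
  apply: (@le_trans _ _ (Pi^-1 * (646 + 184 * (X / N)))).
    have -> : E / e - C / (Pi * w) * X = (E - Pi^-1 * e * (C / w * X)) / e.
      field; rewrite ?gt_eqF//.
    by rewrite normrM normfV (gtr0_norm e0) ler_pdivrMr// [leRHS]mulrAC.
  have ip : Pi^-1 <= 1 / 2 :> R by rewrite div1r lef_pV2 ?posrE.
  have q0 : 0 <= X / N by rewrite divr_ge0// ltW.
  (* [pi >= 2] is used twice: [(646 + 184 X / N) / 2] is at most [28^2 (X / N + 1)], and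
     [28 <= 14 pi]. *)
  have p14 : 28 ^+ 2 <= (14 * Pi) ^+ 2 :> R.
    by rewrite lerXn2r ?nnegrE//; lra.
  apply: (@le_trans _ _ (1 / 2 * (646 + 184 * (X / N)))).
    have : 0 <= 646 + 184 * (X / N) by move: q0; lra.
    by move: (646 + _) => K K0; rewrite ler_wpM2r.
  apply: (@le_trans _ _ (28 ^+ 2 * (X / N + 1))); first by move: q0; lra.
  by rewrite ler_pM2r.
have cJ : c * Jv = X * b by rewrite -XE mulrAC divfK ?gt_eqF.
have S0 : 0 < c * Jv + b * (a * y).
  by rewrite cJ ltr_wpDl ?mulr_gt0// mulr_ge0// ltW.
by rewrite -XE /N; field; rewrite !gt_eqF.
Qed.

End threshold.

Theorem theorem1 (R : realType) (r alpha beta : R) (p p' : \bar R)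
  (r_gt0 : 0 < r) (r_lt1 : r < 1) (p_ge1 : (1 <= p)%E)
  (alpha_gt0 : 0 < alpha) (pp' : (p^-1 + p'^-1 = 1)%E)
  (n : nat) (n_ge : (n0 alpha r p <= n)%N) :
  exists gamma : R, `|gamma| <= (14 * pi) ^+ 2 /\
    fourier_error n alpha r beta p =
    (expR (- alpha * n%:R `^ r) * n%:R `^ ((1 - r) * rinv p) *
     (fine (normL p' cos) / (pi `^ (1 + rinv p') * (alpha * r) `^ rinv p)
        * J p' (pi * n%:R `^ (1 - r) / (alpha * r))
      + gamma *
        (1 / (alpha * r) `^ (1 + rinv p)
           * J p' (pi * n%:R `^ (1 - r) / (alpha * r)) * (1 / n%:R `^ r)
         + 1 / n%:R `^ ((1 - r) * rinv p))))%:E.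
Proof.
have r01 : 0 < r < 1 by rewrite r_gt0.
have [npos N14 d14] := n0_le_bounds alpha_gt0 r01 p_ge1 n_ge.
have nR : 0 < n%:R :> R by rewrite ltr0n.
have a0 : 0 < alpha * r by rewrite mulr_gt0.
have d0 := dlt_gt0 alpha_gt0 r01 npos.
have yd : n%:R `^ (1 - r) / (alpha * r) = (dlt alpha r n)^-1.
  rewrite powR_sub1// /dlt.
  by field; rewrite !gt_eqF// powR_gt0.
have e0 := expR_gt0 (- alpha * n%:R `^ r).
have vE : pi * n%:R `^ (1 - r) / (alpha * r) = pi / dlt alpha r n.
  by rewrite -mulrA yd.
rewrite vE.
have [[pE p'E]|[s [s1 p'E rp]]] := conjugate_cases p_ge1 pp'.
  have [E EE Ebd] :=
    one_exponent_estimate beta alpha_gt0 r01 npos N14 d14.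
  have rp1 : rinv (1%E : \bar R) = 1 by rewrite /rinv inve1.
  rewrite pE p'E rp1 EE J_pinfty ?divr_gt0 ?pi_gt0// normL_pinfty_cos/=.
  have rp0 : rinv (+oo%E : \bar R) = 0 by rewrite /rinv invey.
  rewrite rp0.
  (* At [p = 1] both J and the norm of the cosine equal 1, so the main term is [1 / d]. *)
  have XE : n%:R `^ ((1 - r) * 1) / (alpha * r) `^ 1 * 1 = (dlt alpha r n)^-1.
    by rewrite !mulr1 powRr1 ?(ltW a0).
  have id0 : 0 <= (dlt alpha r n)^-1 by rewrite invr_ge0 ltW.
  have [|gamma [g1 g2]] := @error_form _ _ _ _ _ 0 1 _ _ E _ nR a0 e0 id0 XE.
    rewrite powRr0 divr1 mul1r (le_trans Ebd)// ler_pM2l.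
      have : 0 <= (dlt alpha r n)^-1 / Neps alpha r n.
        by rewrite divr_ge0// (le_trans _ N14).
      by rewrite -/(Neps alpha r n); lra.
    by rewrite mulr_gt0// invr_gt0 pi_gt0.
  by exists gamma; split => //; congr EFin.
have s0 : 0 < s := lt_le_trans ltr01 s1.
have rp' : rinv p' = s^-1 by rewrite p'E /rinv inver gt_eqF.
have pps : (p^-1 + s%:E^-1)%E = 1%E by rewrite -p'E.
have [E EE] :=
  finite_exponent_estimate beta alpha_gt0 r01 npos N14 d14 p_ge1 s1 pps.
rewrite EE rp' rp p'E (pnormE bounded_measurable_cos1 (ltW s0)) [fine _]/=.
set X := rho_integral _ _ `^ _ => Ebd.
have X0 : 0 <= X by exact: powR_ge0.
have JE := J_rho d0 s1.
(* The prefactor is [(1 / d)^(1/p)], the inverse of the power of d in [J_rho]. *)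
have XE : n%:R `^ ((1 - r) * (1 - s^-1)) / (alpha * r) `^ (1 - s^-1) *
    J s%:E (pi / dlt alpha r n) = X.
  have -> : n%:R `^ ((1 - r) * (1 - s^-1)) =
      (alpha * r) `^ (1 - s^-1) * (dlt alpha r n)^-1 `^ (1 - s^-1).
    by rewrite powRrM -powRM ?invr_ge0 ?(ltW a0) ?(ltW d0)// -yd mulrC mulfVK// gt_eqF.
  rewrite JE -/X mulrA [_ * _ `^ _ / _]mulrAC divff ?gt_eqF ?powR_gt0// mul1r.
  by rewrite -powRM ?invr_ge0 ?(ltW d0)// mulVf ?gt_eqF// powR1 mul1r.
have [|gamma [g1 g2]] := @error_form _ _ _ _ _ s^-1 (pnorm s cos) _ _ E _ nR a0 e0 X0 XE.
  (* The factor [2^(1/s)] from the two halves of [rho_fold] cancels against [(2 pi)^(1/s)], leaving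
     [pi^(1/s)]. *)
  suff -> : pnorm s cos / pi `^ s^-1 * X =
      pnorm s cos / (2 * pi) `^ s^-1 * (2 `^ s^-1 * X) by exact: Ebd.
  rewrite powRM ?pi_ge0//; field.
  by rewrite !gt_eqF ?powR_gt0 ?pi_gt0.
by exists gamma; split => //; congr EFin.
Qed.
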